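(* Let $A$ be a closed subset of a metrizable space $X$. (a) If $A$ is compact, then $X/A$ is fine shape equivalent to $X\cup_A CA$, where $CA$ is the cone over $A$. (b) $(X\times I)\setminus Q$ is fine shape equivalent to $(X\times\{0\}\cup A\times I)\setminus Q$ for any $Q\subset(\mathrm{Int}\,A)\times I$, where $\mathrm{Int}\,A$ is the interior of $A$ in $X$.
   Context: $I=[0,1]$. In (a), $X/A$ is the quotient space obtained by shrinking $A$ to a point, $CA=A\times I/A\times\{1\}$, and $X\cup_A CA$ is obtained by identifying $A\subset X$ with $A\times\{0\}\subset CA$ (these are metrizable since $A$ is compact). Fine shape category. Maps are continuous. Absolute retracts (ARs) are those for metrizable spaces. A closed subset $X$ of an AR $M$ is a Z-set if there is a homotopy $h_t\colon M\to M$ with $h_0=\mathrm{id}$ and $h_t(M)\subset M\setminus X$ for $t>0$. Every metrizable space embeds as a Z-set in some AR. If $X\subset M$ and $Y\subset N$ are closed subsets of metrizable spaces, a map $f\colon M\setminus X\to N\setminus Y$ is $X$-$Y$-approaching if it sends every sequence having a cluster point in $X$ to a sequence having a cluster point in $Y$. An $X$-$Y$-approaching homotopy is a homotopy $(M\setminus X)\times I\to N\setminus Y$ that is an $(X\times I)$-$Y$-approaching map. If $X$, $Y$ are Z-sets in ARs $M$, $N$ and $\varphi\colon X\to Y$ is a map, $\varphi_{MN}\colon M\setminus X\to N\setminus Y$ denotes an $X$-$Y$-approaching map combining with $\varphi$ into a continuous map $M\to N$ (it exists and is unique up to $X$-$Y$-approaching homotopy). The objects of the fine shape category are metrizable spaces.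 $X$-$Y$-approaching maps $\Phi\colon M\setminus X\to N\setminus Y$ and $\Phi'\colon M'\setminus X\to N'\setminus Y$ (with $X$ a Z-set in ARs $M,M'$ and $Y$ a Z-set in ARs $N,N'$) represent the same fine shape morphism $X\to Y$ if $(\mathrm{id}_Y)_{NN'}\Phi$ and $\Phi'(\mathrm{id}_X)_{MM'}$ are $X$-$Y$-approaching homotopic; fine shape morphisms are the equivalence classes, and composition is induced by composition of representatives $M\setminus X\to N\setminus Y\to L\setminus Z$. Metrizable spaces are fine shape equivalent if they are isomorphic in the fine shape category. *)

(* Defs.v *)
From HB Require Import structures.
From Stdlib Require Import Relation_Operators.
From mathcomp Require Import all_boot all_order all_algebra generic_quotient.
From mathcomp Require Import all_classical all_reals topology.

Set Implicit Arguments.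
Unset Strict Implicit.
Unset Printing Implicit Defensive.

Import Order.TTheory GRing.Theory Num.Theory.
Import numFieldTopology.Exports.

Local Open Scope classical_set_scope.
Local Open Scope ring_scope.

Definition unit_interval (R : realType) : topologicalType :=
  set_type (`[0, 1]%classic : set R).

Lemma itv01_0 (R : realType) : (0 : R) \in (`[0, 1]%classic : set R).
Proof. by rewrite inE /= in_itv /= lexx ler01. Qed.

Lemma itv01_1 (R : realType) : (1 : R) \in (`[0, 1]%classic : set R).
Proof. by rewrite inE /= in_itv /= lexx ler01. Qed.

Definition I0 (R : realType) : unit_interval R := exist _ 0 (itv01_0 R).
Definition I1 (R : realType) : unit_interval R := exist _ 1 (itv01_1 R).

Definition metrizable (R : realType) (T : topologicalType) : Prop :=
  exists (M : metricType R) (f : T -> M) (g : M -> T),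
    [/\ cancel f g, cancel g f, continuous f & continuous g].

Definition closed_embedding (X Y : topologicalType) (e : X -> Y) : Prop :=
  [/\ injective e, continuous e,
      forall U : set X, open U -> exists2 V : set Y, open V & U = e @^-1` V
    & closed (range e)].

(* The empty space is excluded automatically: it is closed in a point but
   is not a retract of it. *)
Definition absolute_retract (R : realType) (M : topologicalType) : Prop :=
  metrizable R M /\
  forall (Z : topologicalType) (e : M -> Z),
    metrizable R Z -> closed_embedding e ->
    exists2 r : Z -> M, continuous r & cancel e r.

Definition Zset (R : realType) (M : topologicalType) (X : set M) : Prop :=
  closed X /\
  exists h : M * unit_interval R -> M,
    [/\ continuous h, forall x, h (x, I0 R) = x
      & forall x t, 0 < set_val t -> ~ X (h (x, t))].

(* [f : M \ X -> N \ Y], where [~` X] is used as a subspace of [M]. *)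
Definition approaching (M N : topologicalType) (X : set M) (Y : set N)
    (f : ~` X -> ~` Y) : Prop :=
  continuous f /\
  forall u : nat -> ~` X,
    (exists2 x, X x & cluster ((set_val \o u) @ \oo) x) ->
    exists2 y, Y y & cluster ((set_val \o f \o u) @ \oo) y.

Lemma cylinder_subproof (T S : Type) (X : set T) (p : (~` X) * S) :
  (set_val p.1, p.2) \in ~` (X `*` [set: S]).
Proof. by rewrite inE => -[/= Xp _]; exact: set_valP p.1 Xp. Qed.

(* The identification of (M \ X) * S with (M * S) \ (X * S). *)
Definition cylinder (T S : Type) (X : set T) (p : (~` X) * S) :
    ~` (X `*` [set: S]) :=
  exist _ (set_val p.1, p.2) (cylinder_subproof p).

Definition approaching_homotopic (R : realType) (M N : topologicalType)
    (X : set M) (Y : set N) (f g : ~` X -> ~` Y) : Prop :=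
  exists H : ~` (X `*` [set: unit_interval R]) -> ~` Y,
    [/\ approaching H, forall x, H (cylinder (x, I0 R)) = f x
      & forall x, H (cylinder (x, I1 R)) = g x].

(* An AR containing a copy of X as a Z-set. *)
Record ZsetAR (R : realType) (X : topologicalType) := MkZsetAR {
  AR_space :> topologicalType;
  AR_emb : X -> AR_space;
  AR_spaceP : absolute_retract R AR_space;
  AR_embP : closed_embedding AR_emb;
  AR_Zset : Zset R (range AR_emb) }.

Definition Zimage (R : realType) (X : topologicalType) (M : ZsetAR R X) : set M :=
  range (@AR_emb R X M).
Arguments Zimage {R X} M.

(* [Phi] is a possible choice of phi_{MN}; the latter is only defined up to
   approaching homotopy. *)
Definition combines (R : realType) (X Y : topologicalType)
    (M : ZsetAR R X) (N : ZsetAR R Y) (phi : X -> Y)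
    (Phi : ~` Zimage M -> ~` Zimage N) : Prop :=
  approaching Phi /\
  exists f : M -> N,
    [/\ continuous f, forall x, f (AR_emb M x) = AR_emb N (phi x)
      & forall z : ~` Zimage M, f (set_val z) = set_val (Phi z)].

Record fs_rep (R : realType) (X Y : topologicalType) := MkFsRep {
  rep_src : ZsetAR R X;
  rep_tgt : ZsetAR R Y;
  rep_map :> ~` Zimage rep_src -> ~` Zimage rep_tgt;
  rep_mapP : approaching rep_map }.

Definition fs_rep_equiv (R : realType) (X Y : topologicalType)
    (Phi Phi' : fs_rep R X Y) : Prop :=
  exists (i : ~` Zimage (rep_src Phi) -> ~` Zimage (rep_src Phi'))
         (j : ~` Zimage (rep_tgt Phi) -> ~` Zimage (rep_tgt Phi')),
    [/\ combines id i, combines id j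
      & approaching_homotopic R (j \o Phi) (Phi' \o i)].

Record fs_morphism (R : realType) (X Y : topologicalType) := MkFsMorphism {
  (* not [set (fs_rep R X Y)], for universe reasons *)
  fs_class :> fs_rep R X Y -> Prop;
  fs_classP : exists Phi, forall Phi', fs_class Phi' <-> fs_rep_equiv Phi Phi' }.

Lemma approaching_id (M : topologicalType) (X : set M) :
  approaching (id : ~` X -> ~` X).
Proof. by split=> [x|u] //; exact: cvg_id. Qed.

Lemma approaching_comp (M N L : topologicalType) (X : set M) (Y : set N)
    (Z : set L) (f : ~` X -> ~` Y) (g : ~` Y -> ~` Z) :
  approaching f -> approaching g -> approaching (g \o f).
Proof.
move=> [cf af] [cg ag]; split=> [x|u /af clu].
  by apply: continuous_comp; [exact: cf|exact: cg].
exact: (ag (f \o u)).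
Qed.

Definition rep_id (R : realType) (X : topologicalType) (M : ZsetAR R X) :
    fs_rep R X X :=
  MkFsRep (@approaching_id M (Zimage M)).

Definition is_fs_id (R : realType) (X : topologicalType)
    (F : fs_morphism R X X) : Prop :=
  exists M : ZsetAR R X, F (rep_id M).

(* [H] is the composite [G o F], the class of a composite of representatives
   M \ X -> N \ Y -> L \ Z that share the middle AR. *)
Definition is_fs_comp (R : realType) (X Y Z : topologicalType)
    (F : fs_morphism R X Y) (G : fs_morphism R Y Z) (H : fs_morphism R X Z) :
    Prop :=
  exists (M : ZsetAR R X) (N : ZsetAR R Y) (L : ZsetAR R Z)
         (Phi : ~` Zimage M -> ~` Zimage N) (Psi : ~` Zimage N -> ~` Zimage L)
         (aPhi : approaching Phi) (aPsi : approaching Psi),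
    [/\ F (MkFsRep aPhi), G (MkFsRep aPsi)
      & H (MkFsRep (approaching_comp aPhi aPsi))].

(* Metrizability of X and Y is implied: a morphism X -> Y embeds both of them
   in metrizable ARs. *)
Definition fine_shape_equivalent (R : realType) (X Y : topologicalType) :
    Prop :=
  exists (F : fs_morphism R X Y) (G : fs_morphism R Y X)
         (idX : fs_morphism R X X) (idY : fs_morphism R Y Y),
    [/\ is_fs_id idX, is_fs_id idY, is_fs_comp F G idX & is_fs_comp G F idY].

Section quotient_by.
Local Open Scope quotient_scope.
Context (T : topologicalType) (r : T -> T -> Prop).

Let gen_rel (x y : T) : bool := `[< clos_refl_sym_trans T r x y >].

Lemma gen_rel_refl : reflexive gen_rel.
Proof. by move=> x; apply/asboolP; exact: rst_refl. Qed.

Lemma gen_rel_sym : symmetric gen_rel.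
Proof. by move=> x y; apply/asboolP/asboolP => ?; exact: rst_sym. Qed.

Lemma gen_rel_trans : transitive gen_rel.
Proof.
move=> y x z /asboolP xy /asboolP yz; apply/asboolP; exact: rst_trans yz.
Qed.

Definition gen_equiv := EquivRel gen_rel gen_rel_refl gen_rel_sym gen_rel_trans.

Definition quotient_by : topologicalType :=
  quotient_topology {eq_quot gen_equiv}.

Definition quotient_by_pi (x : T) : quotient_by := \pi_({eq_quot gen_equiv}) x.

End quotient_by.

(* For empty A this is X itself, and [cone set0] below is empty. *)
Definition collapse (X : topologicalType) (A : set X) : topologicalType :=
  quotient_by (fun x y : X => A x /\ A y).

Definition cone (R : realType) (X : topologicalType) (A : set X) :
    topologicalType :=
  quotient_by (fun p q : A * unit_interval R => p.2 = I1 R /\ q.2 = I1 R).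

Definition cone_point (R : realType) (X : topologicalType) (A : set X)
    (p : A * unit_interval R) : cone R A := quotient_by_pi _ p.

Definition summand (X Y : topologicalType) (b : bool) : topologicalType :=
  if b then X else Y.

Definition disjoint_sum (X Y : topologicalType) : topologicalType :=
  {b : bool & summand X Y b}.

Definition in_left (X Y : topologicalType) (x : X) : disjoint_sum X Y :=
  existT (summand X Y) true x.

Definition in_right (X Y : topologicalType) (y : Y) : disjoint_sum X Y :=
  existT (summand X Y) false y.

Definition attach_cone (R : realType) (X : topologicalType) (A : set X) :
    topologicalType :=
  quotient_by (fun u v : disjoint_sum X (cone R A) =>
    exists a : A, u = in_left _ (set_val a) /\
                  v = in_right _ (cone_point (a, I0 R))).

(* Main.v *)
From HB Require Import structures.
Require Import Defs.
From Stdlib Require Import Relation_Operators.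
From mathcomp Require Import all_boot all_order all_algebra generic_quotient.
From mathcomp Require Import all_classical all_reals topology normedtype.
From mathcomp Require Import ring lra.

(* An embedding [e] of a metrizable space [X] into the cube [0, 1]^I with the sup
   metric (for instance [x |-> d(x, -)]) gives the space [M] of all [(s, z)] with
   [s > 0], or [s = 0] and [z] in [e X]. By a uniform version of Hausdorff's
   extension formula the cube is an absolute extensor for metrizable spaces;
   keeping the coordinate [s] positive off the given closed set, so is [M].
   Increasing [s] shows that [X] is a Z-set in [M], with complement
   [0, 1]^I * (0, 1]. It then suffices to find approaching maps between two such
   complements which are mutually inverse up to approaching homotopy.

   For (b), both complements consist of triples [(k, r, s)]. The map induced by
   the inclusion is the identity, and its inverse multiplies [r] by
   [d(k, X \ A) / (d(k, A) + d(k, X \ A) + s)]. As [s] tends to 0 this factor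
   tends to 1 over Int A and to 0 off A; over the frontier it is not controlled,
   but there the whole fibre {x} * I avoids Q and is compact.

   For (a), let [a x = d(x, A)]. Embed X/A by [(a, a k)], and X with the cone
   attached by [(a, 1, k)] on X and by [(0, c, c k)] on the cone, where [c] is the
   height above the vertex. The quotient map multiplies [k] by [a]; its inverse
   divides by [a], at the height [c = max(0, a^2 - D - s) / max(a^2, s)], where
   [D] is the distance to X/A. Near the collapsed point either [c] tends to 0 or
   the direction is determined up to an error O(a) by a point of X close to A; by
   compactness of A it then clusters at A. *)

Set Implicit Arguments.
Unset Strict Implicit.
Unset Printing Implicit Defensive.

Import Order.TTheory GRing.Theory Num.Def Num.Theory.
Import numFieldTopology.Exports numFieldNormedType.Exports.

Local Open Scope classical_set_scope.
Local Open Scope ring_scope.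

(** * Uniform convergence and the sup distance *)

Section uniform_convergence.
Context {R : realType}.

Definition unitf (I : Type) (z : I -> R) : Prop := forall i, 0 <= z i <= 1.

(** Convergence in the sup metric of the cube, not in the product topology. Arbitrary filters are
    allowed, so that one notion serves for continuity (neighbourhood filters) and for behaviour at
    the Z-set (ultrafilters). *)
Definition ucvg (T I : Type) (F : set_system T) (w : T -> I -> R) (l : I -> R)
  :=
  forall e, 0 < e -> \forall t \near F, forall i, `|w t i - l i| <= e.

Section along_filter.
Context {T : Type} {F : set_system T} {FF : Filter F}.

Lemma ucvg_ext I (w w' : T -> I -> R) l :
  (\forall t \near F, w t = w' t) -> ucvg F w l -> ucvg F w' l.
Proof.
by move=> ww' wl e /wl; apply: filterS2 ww' => t <-.
Qed.

Lemma ucvg_cst I (l : I -> R) : ucvg F (fun=> l) l.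
Proof. by move=> e e0; apply: nearW => t i; rewrite subrr normr0 ltW. Qed.

Lemma ucvg_comp I J (f : J -> I) (w : T -> I -> R) l :
  ucvg F w l -> ucvg F (fun t j => w t (f j)) (fun j => l (f j)).
Proof. by move=> wl e /wl; apply: filterS => t + j; exact. Qed.

Lemma ucvg_at I (w : T -> I -> R) l i : ucvg F w l -> w t i @[t --> F] --> l i.
Proof.
move=> wl; apply/cvgrPdist_le => e /wl; apply: filterS => t /(_ i).
by rewrite distrC.
Qed.

Lemma ucvg_option I (w : T -> option I -> R) l :
  w t None @[t --> F] --> l None ->
  ucvg F (fun t i => w t (Some i)) (fun i => l (Some i)) -> ucvg F w l.
Proof.
move=> /cvgrPdist_le w0 wl e e0; apply: filterS2 (w0 e e0) (wl e e0).
by move=> t + + [i|//]; rewrite distrC.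
Qed.

Lemma ucvgD I (w w' : T -> I -> R) l l' :
  ucvg F w l -> ucvg F w' l' ->
  ucvg F (fun t i => w t i + w' t i) (fun i => l i + l' i).
Proof.
move=> wl wl' e e0; have e2 : 0 < e / 2 by rewrite divr_gt0.
apply: filterS2 (wl _ e2) (wl' _ e2) => t wt wt' i.
by rewrite opprD addrACA (le_trans (ler_normD _ _))// [leRHS]splitr lerD.
Qed.

(** The bound [b] on the limit is what makes the term [(c t - c0) * l i] small uniformly in [i]. *)
Lemma ucvgZ I (c : T -> R) (c0 b : R) (w : T -> I -> R) l :
  (forall i, `|l i| <= b) -> c t @[t --> F] --> c0 -> ucvg F w l ->
  ucvg F (fun t i => c t * w t i) (fun i => c0 * l i).
Proof.
move=> lb cc wl e e0.
have b1 : 0 < `|b| + 1 by rewrite ltr_wpDl.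
have c1 : 0 < `|c0| + 1 by rewrite ltr_wpDl.
have cd : \forall t \near F, `|c t - c0| <= minr 1 (e / 2 / (`|b| + 1)).
  have /cvgrPdist_le := cc; have m0 : 0 < minr 1 (e / 2 / (`|b| + 1)).
    by rewrite lt_min ltr01 !divr_gt0.
  by move=> /(_ _ m0); apply: filterS => t; rewrite distrC.
have e2 : 0 < e / 2 / (`|c0| + 1) by rewrite !divr_gt0.
apply: filterS2 cd (wl _ e2) => t; rewrite le_min => /andP[ct1 ct] wt i.
have -> : c t * w t i - c0 * l i = c t * (w t i - l i) + (c t - c0) * l i
  by ring.
rewrite (le_trans (ler_normD _ _))// [leRHS]splitr lerD// normrM.
  rewrite -[leRHS](divfK (lt0r_neq0 c1)) mulrC ler_pM//.
  rewrite -[c t](subrK c0) addrC (le_trans (ler_normD _ _))// lerD2l//.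
rewrite -[leRHS](divfK (lt0r_neq0 b1)) ler_pM//.
by rewrite (le_trans (lb i))// (le_trans (ler_norm _))// lerDl.
Qed.

Lemma ucvg_min I (w : T -> I -> R) l (a : T -> R) a0 :
  ucvg F w l -> a t @[t --> F] --> a0 ->
  ucvg F (fun t i => minr (w t i) (a t)) (fun i => minr (l i) a0).
Proof.
move=> wl /cvgrPdist_le al e e0; apply: filterS2 (wl e e0) (al e e0).
move=> t wt; rewrite distrC => at_ i; have := wt i.
move: at_; rewrite !ler_norml /minr => /andP[? ?] /andP[? ?].
by case: ltP => ?; case: ltP => ?; lra.
Qed.

Lemma cvg_maxr (f g : T -> R) (a b : R) :
  f t @[t --> F] --> a -> g t @[t --> F] --> b ->
  maxr (f t) (g t) @[t --> F] --> maxr a b.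
Proof.
move=> /cvgrPdist_le fa /cvgrPdist_le gb; apply/cvgrPdist_le => e e0.
apply: filterS2 (fa e e0) (gb e e0) => t; rewrite !ler_norml.
by move=> /andP[? ?] /andP[? ?]; rewrite /maxr; do 2 case: ltP => ?; lra.
Qed.

End along_filter.

Lemma ucvg_sub (T I : Type) (F G : set_system T) (w : T -> I -> R) l :
  F `<=` G -> ucvg F w l -> ucvg G w l.
Proof. by move=> FG wl e /wl /FG. Qed.

Lemma ucvg_unique (T I : Type) (F : set_system T) (w : T -> I -> R) l l' :
  ProperFilter F -> ucvg F w l -> ucvg F w l' -> l = l'.
Proof.
move=> FF wl wl'; apply/funext => i.
exact: (cvg_unique (@Rhausdorff R) (ucvg_at (i := i) wl)
  (ucvg_at (i := i) wl')).
Qed.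

Lemma ultra_fmap (T U : Type) (f : T -> U) (F : set_system T) :
  UltraFilter F -> UltraFilter (f @ F).
Proof.
move=> FU; split=> [|G GF fG]; first exact: fmap_proper_filter.
rewrite eqEsubset; split=> // A GA; have [//|nA] :=
  in_ultra_setVsetC (f @^-1` A) FU.
have : G (A `&` ~` A) by apply: filterI => //; exact: fG.
by rewrite setICr => /filter_not_empty.
Qed.

(** Compactness of [0, 1]. It supplies a limit for every parameter that the formulas below leave
    uncontrolled at the Z-set: the squeezing factor over the frontier, and the height over the
    collapsed point. *)
Lemma ultra_unit_cvg (T : Type) (F : set_system T) (c : T -> R) :
  UltraFilter F -> (forall t, 0 <= c t <= 1) ->
  exists2 l : R, 0 <= l <= 1 & c t @[t --> F] --> l.
Proof.
move=> FU c01; have := @segment_compact R 0 1; rewrite compact_ultra.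
move=> /(_ _ (ultra_fmap c FU))[|l [l01 cl]].
  by apply: nearW => t; rewrite /= in_itv /=; exact: c01.
by exists l => //; move: l01; rewrite /= in_itv.
Qed.

End uniform_convergence.

Arguments ucvg_at {R T F FF I w l} i.

(** * The sup distance on a cube and the distance to a subset *)

Section sup_distance.
Context {R : realType} {I : Type}.
Implicit Types z w : I -> R.

(** The added 0 keeps the set nonempty when [I] is empty and does not change the supremum
    otherwise. *)
Definition sdist z w : R := sup ([set 0] `|` range (fun i => `|z i - w i|)).

Lemma unitf_dist z w i : unitf z -> unitf w -> `|z i - w i| <= 1.
Proof.
move=> /(_ i)/andP[? ?] /(_ i)/andP[? ?]; rewrite ler_norml; lra.
Qed.

Lemma sdist_le z w e : unitf z -> unitf w -> 0 <= e ->
  sdist z w <= e <-> forall i, `|z i - w i| <= e.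
Proof.
move=> zu wu e0; split=> [zwe i|zwe].
  apply: le_trans zwe; apply: ub_le_sup; last by right; exists i.
  by exists 1 => _ [->|[j _ <-]]; [exact: ler01|exact: unitf_dist].
apply: ge_sup; first by exists 0; left.
by move=> _ [->|[j _ <-]].
Qed.

Lemma sdist_ge0 z w : unitf z -> unitf w -> 0 <= sdist z w.
Proof.
move=> zu wu; apply: ub_le_sup; last by left.
by exists 1 => _ [->|[j _ <-]]; [exact: ler01|exact: unitf_dist].
Qed.

Lemma sdist_le1 z w : unitf z -> unitf w -> sdist z w <= 1.
Proof. by move=> zu wu; apply/(sdist_le zu wu ler01) => i; exact: unitf_dist.
  Qed.

Lemma sdist_at z w i : unitf z -> unitf w -> `|z i - w i| <= sdist z w.
Proof. by move=> zu wu; move: i; apply/(sdist_le zu wu (sdist_ge0 zu wu)). Qed.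

Lemma sdistxx z : unitf z -> sdist z z = 0.
Proof.
move=> zu; apply/eqP; rewrite eq_le sdist_ge0// andbT.
by apply/sdist_le => // i; rewrite subrr normr0.
Qed.

Lemma sdist_sym z w : sdist z w = sdist w z.
Proof.
rewrite /sdist; suff -> : (fun i => `|z i - w i|) = (fun i => `|w i - z i|)
  by [].
by apply/funext => i; rewrite distrC.
Qed.

Lemma sdist_triangle w z y : unitf z -> unitf w -> unitf y ->
  sdist z y <= sdist z w + sdist w y.
Proof.
move=> zu wu yu; apply/sdist_le => //; first by rewrite addr_ge0// sdist_ge0.
move=> i; rewrite -(subrKA (w i)) (le_trans (ler_normD _ _))// lerD//.
  exact: sdist_at.
exact: sdist_at.
Qed.

Lemma sdist_eq0 z w : unitf z -> unitf w -> sdist z w = 0 -> z = w.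
Proof.
move=> zu wu zw; apply/funext => i; apply/eqP; rewrite -subr_eq0 -normr_le0 -zw.
exact: sdist_at.
Qed.

Lemma ucvg_sdist (T : Type) (F : set_system T) (FF : Filter F)
    (w : T -> I -> R) (l : I -> R) :
  (forall t, unitf (w t)) -> unitf l ->
  ucvg F w l <-> sdist (w t) l @[t --> F] --> (0 : R).
Proof.
move=> wu lu; split=> [wl|/cvgrPdist_le wl e e0].
  apply/cvgrPdist_le => e e0; move: (wl e e0); apply: filterS => t wt.
  rewrite sub0r normrN ger0_norm ?sdist_ge0//; apply/sdist_le => //; exact: ltW.
move: (wl e e0); apply: filterS => t.
rewrite sub0r normrN ger0_norm ?sdist_ge0// => wt i.
by apply: le_trans wt; exact: sdist_at.
Qed.

(* The cap 1 gives the value 1, rather than the junk value [inf set0], when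
   [C] is empty. *)
Definition setdist (C : set (I -> R)) z : R :=
  inf ([set 1] `|` [set sdist z c | c in C]).

Context {C : set (I -> R)} (Cu : forall c, C c -> unitf c).

Let lb0 z : unitf z -> lbound ([set 1] `|` [set sdist z c | c in C]) 0.
Proof. by move=> zu _ [->|[c Cc <-]] //; apply: sdist_ge0 => //; exact: Cu. Qed.

Lemma setdist_ge0 z : unitf z -> 0 <= setdist C z.
Proof. by move=> zu; apply: lb_le_inf; [exists 1; left|exact: lb0]. Qed.

Lemma setdist_le1 z : unitf z -> setdist C z <= 1.
Proof. by move=> zu; apply: ge_inf; [exists 0; exact: lb0|left]. Qed.

Lemma setdist_le z c : unitf z -> C c -> setdist C z <= sdist z c.
Proof.
by move=> zu Cc; apply: ge_inf; [exists 0; exact: lb0|right; exists c].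
Qed.

Lemma setdist_lt z e : unitf z -> C !=set0 -> setdist C z < e ->
  exists2 c, C c & sdist z c < e.
Proof.
move=> zu [c0 Cc0] ze; have hi : has_inf ([set 1] `|` [set sdist z c | c in C]).
  by split; [exists 1; left|exists 0; exact: lb0].
have [_ [->|[c Cc <-]] ce] := inf_lt hi.1 ze.
  by exists c0 => //; apply: le_lt_trans ce; apply: sdist_le1 => //; exact: Cu.
by exists c.
Qed.

Lemma setdist_lip z w : unitf z -> unitf w ->
  setdist C z <= setdist C w + sdist z w.
Proof.
move=> zu wu; rewrite -lerBlDr; apply: lb_le_inf; first by exists 1; left.
move=> _ [->|[c Cc <-]]; rewrite lerBlDr.
  by rewrite (le_trans (setdist_le1 zu))// lerDl sdist_ge0.
rewrite (le_trans (setdist_le zu Cc))// addrC sdist_triangle//.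
exact: Cu.
Qed.

Lemma setdist_mem z : unitf z -> C z -> setdist C z = 0.
Proof.
move=> zu Cz; apply/eqP; rewrite eq_le setdist_ge0// andbT -(sdistxx zu).
exact: setdist_le.
Qed.

Lemma cvg_setdist (T : Type) (F : set_system T) (FF : Filter F)
    (w : T -> I -> R) (l : I -> R) :
  (forall t, unitf (w t)) -> unitf l -> ucvg F w l ->
  setdist C (w t) @[t --> F] --> setdist C l.
Proof.
move=> wu lu /(ucvg_sdist FF wu lu) /cvgrPdist_le wl.
apply/cvgrPdist_le => e /wl; apply: filterS => t.
rewrite sub0r normrN ger0_norm ?sdist_ge0// => wt.
have := setdist_lip (wu t) lu; have := setdist_lip lu (wu t).
rewrite (sdist_sym l) ler_norml => h1 h2.
move: (setdist C l) (setdist C (w t)) h1 h2 => x y h1 h2.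
by apply/andP; split; lra.
Qed.

End sup_distance.

(** * Embeddings into cubes *)

Section uniform_embedding.
Context {R : realType}.

(** The equivalence for all filters says that the topology of [T] is the one induced by the sup
    metric through [k]; its two directions are continuity of [k] and of its inverse. *)
Definition uembedding (T : topologicalType) (I : Type) (k : T -> I -> R) :
  Prop :=
  [/\ forall x, unitf (k x), injective k
    & forall x (F : set_system T), Filter F -> F --> x <-> ucvg F k (k x)].

Lemma metrizable_uembedding (T : topologicalType) :
  metrizable R T -> exists k : T -> T -> R, uembedding k.
Proof.
move=> [M [f [g [fK gK cf cg]]]].
pose d (x y : T) : R := mdist (f x) (f y).
have d0 x y : 0 <= d x y by exact: mdist_ge0.
have dD x y z : d x z <= d x y + d y z by exact: metric_triangle.
have dC x y : d x y = d y x by exact: metric_sym.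
have dxx x : d x x = 0 by exact: mdistxx.
have dk x y z : `|minr 1 (d x z) - minr 1 (d y z)| <= d x y.
  have := dD x y z; have := dD y x z; have := d0 x z; have := d0 y z.
  have := d0 x y; rewrite (dC y x) ler_norml /minr => *.
  by apply/andP; case: ltP => ?; case: ltP => ?; split; lra.
exists (fun x y => minr 1 (d x y)); split.
- by move=> x y; rewrite le_min ler01 d0 ge_min lexx.
- move=> x y /(congr1 (@^~ y)); rewrite dxx (min_idPr ler01) => /eqP.
  rewrite /minr; case: ltP => _; first by rewrite oner_eq0.
  by move=> /eqP /mdist_positivity /(can_inj fK).
- move=> x F FF; have -> : F --> x <-> f @ F --> f x.
    split=> [Fx V /cf xV|fFx V]; first exact: Fx.
    rewrite -{1}(fK x) => /cg /fFx; rewrite /nbhs /=; apply: filterS => y /=.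
    by rewrite fK.
  split=> [/cvg_ballP fF e e0|kF].
    have := fF e e0; apply: filterS => y; rewrite ballEmdist /= => xy z.
    by apply: (le_trans (dk _ _ _)); rewrite dC; exact: ltW.
  apply/cvg_ballP => e e0.
  (* A bound below 1 on the truncated distance is a bound on the distance itself. *)
  have m0 : 0 < minr 1 e / 2 by rewrite divr_gt0// lt_min ltr01.
  have := kF _ m0; apply: filterS => y /(_ x).
  rewrite dxx (min_idPr ler01) subr0 ballEmdist /= -/(d x y) (dC y).
  rewrite ger0_norm; last by rewrite le_min ler01 d0.
  by rewrite /minr; case: (ltP 1 e); case: (ltP 1 (d x y)) => ? ? ?; lra.
Qed.

Context {T : topologicalType} {I : Type} (k : T -> I -> R).

Lemma uembedding_ball x e : uembedding k -> 0 < e ->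
  nbhs x [set y | sdist (k y) (k x) < e].
Proof.
move=> [ku _ kc] e0.
have /(ucvg_sdist _ ku (ku x)) : ucvg (nbhs x) k (k x).
  exact: (kc x (nbhs x) _).1.
move=> /cvgrPdist_lt /(_ e e0); apply: filterS => y /=.
by rewrite sub0r normrN ger0_norm ?sdist_ge0.
Qed.

(** The filter generated by the traces of the sup balls around [k x] converges uniformly to [k x],
    hence to [x], so it contains every neighbourhood of [x]. *)
Lemma uembedding_nbhs x V : uembedding k -> nbhs x V ->
  exists2 e, 0 < e & forall y, sdist (k y) (k x) < e -> V y.
Proof.
move=> [ku _ kc]; pose F := filter_from [set e : R | 0 < e]
  (fun e => [set y | sdist (k y) (k x) < e]).
have FF : Filter F.
  apply: filter_from_filter; first by exists 1; exact: ltr01.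
  move=> e e' e0 e'0; exists (minr e e'); first by rewrite /= lt_min e0.
  by move=> y /=; rewrite lt_min => /andP[].
have /(kc x F FF) Fx : ucvg F k (k x).
  apply/(ucvg_sdist _ ku (ku x))/cvgrPdist_lt => e e0; exists e => // y /=.
  by rewrite sub0r normrN ger0_norm ?sdist_ge0.
by move=> /Fx.
Qed.

(** If [F] misses a neighbourhood [V], the traces of [F] on the complement of [V] generate a proper
    filter, and an ultrafilter above it contradicts the last hypothesis. The gain is that
    compactness arguments become available. *)
Lemma ultra_uembedding : (forall x, unitf (k x)) -> injective k ->
  (forall x, ucvg (nbhs x) k (k x)) ->
  (forall x (U : set_system T), UltraFilter U -> ucvg U k (k x) -> U --> x) ->
  uembedding k.
Proof.
move=> ku kI kc kU; split=> // x F FF; split=> [Fx|kF V Vx].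
  exact: ucvg_sub Fx (kc x).
apply: contrapT => FV.
pose G := filter_from F (fun W => W `&` ~` V).
have PG : ProperFilter G.
  apply: filter_from_proper.
    apply: filter_from_filter; first by exists setT; exact: filterT.
    move=> P Q FP FQ; exists (P `&` Q); first exact: filterI.
    by move=> y [[Py Qy] Vy].
  move=> W FW; apply: contrapT => /set0P/negP/negPn/eqP WV; apply: FV.
  by apply: filterS FW => y Wy; apply: contrapT => Vy; suff : set0 y by [];
    rewrite -WV.
have [U [UU GU]] := ultraFilterLemma PG.
have UV : U V.
  apply: (kU x U UU) => //; apply: ucvg_sub kF => W FW; apply: GU.
  by exists W => // y [].
have : U (V `&` ~` V).
  by apply: filterI => //; apply: GU; exists setT; [exact: filterT|move=> y []].
by rewrite setICr => /filter_not_empty.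
Qed.

End uniform_embedding.

(** * Absolute retracts containing a given space as a Z-set *)

(** The coordinate [None] is the coordinate s of the overview. Packing (s, z) into one function on
    [option I] lets a single sup distance measure both. *)
Record model (R : realType) (I : Type) (B : set (I -> R)) := Model {
  mval :> option I -> R;
  mvalP : unitf mval /\ (0 < mval None \/ mval None = 0 /\ B (mval \o some)) }.

Section model_metric.
Context {R : realType} {I : Type} (B : set (I -> R)).
Implicit Types m : model B.

Lemma mval_inj : injective (@mval R I B).
Proof.
move=> [z zP] [w wP] /= zw; rewrite -zw in wP *; congr Model.
exact: Prop_irrelevance.
Qed.

Lemma mval_unit m : unitf m.
Proof. by case: (mvalP m). Qed.

HB.instance Definition _ := gen_eqMixin (model B).
HB.instance Definition _ := gen_choiceMixin (model B).

Let mdist0 m : sdist m m = 0.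
Proof. exact/sdistxx/mval_unit. Qed.

Let mdist_eq0 m m' : sdist m m' = 0 -> m = m'.
Proof. by move=> /sdist_eq0 mm'; apply/mval_inj/mm'; exact: mval_unit. Qed.

Let mdistC m m' : sdist m m' = sdist m' m.
Proof. exact: sdist_sym. Qed.

Let mdistD m2 m1 m3 : sdist m1 m3 <= sdist m1 m2 + sdist m2 m3.
Proof. by apply: sdist_triangle; exact: mval_unit. Qed.

HB.instance Definition _ := isMetric.Build R (model B)
  mdist0 mdist_eq0 mdistC mdistD.

Lemma model_metrizable : metrizable R (model B).
Proof. by exists (model B), id, id; split=> // x; exact: cvg_id. Qed.

Lemma model_uembedding : uembedding (@mval R I B).
Proof.
split; [exact: mval_unit|exact: mval_inj|move=> m F FF].
split=> [/cvg_ballP mF|/(ucvg_sdist _ mval_unit (mval_unit m)) /cvgrPdist_lt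
  mF].
  apply/(ucvg_sdist _ mval_unit (mval_unit m))/cvgrPdist_lt => e /mF.
  apply: filterS => m'; rewrite ballEmdist /= sub0r normrN.
  by rewrite ger0_norm ?sdist_ge0//; [rewrite sdist_sym|exact: mval_unit..].
apply/cvg_ballP => e /mF; apply: filterS => m'; rewrite ballEmdist /=.
by rewrite sub0r normrN ger0_norm ?sdist_ge0//;
  [rewrite sdist_sym|exact: mval_unit..].
Qed.

Lemma cvg_model (T : Type) (F : set_system T) (FF : Filter F) (f : T ->
  model B) m :
  f @ F --> m <-> ucvg F (fun t => mval (f t)) m.
Proof. by have [_ _ /(_ m (f @ F) _)] := model_uembedding. Qed.

End model_metric.

(* A uniform form of Hausdorff's extension formula
   [inf_m (m i + d(z, e m) / d(z, range e)) - 1]. *)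
Section hausdorff_extension.
Context {R : realType} {I J : Type} {B : set (I -> R)}.
Context {Z : topologicalType} {k : Z -> J -> R} (ku : uembedding k).
Context {e : model B -> Z} (eE : closed_embedding e).

Let D z := setdist (range (k \o e)) (k z).
Let G z (i : option I) :=
  inf (range (fun m : model B => m i * D z + sdist (k z) (k (e m)))).

Let kunit z : unitf (k z).
Proof. by case: ku. Qed.

Let ru c : range (k \o e) c -> unitf c.
Proof. by move=> [m _ <-]; exact: kunit. Qed.

(** The constant 1 has s > 0, so it lies in every model; the infima below therefore range over
    nonempty sets even when [B] is empty. *)
Let m1 : model B.
Proof.
apply: (@Model R I B (fun=> 1)); split; first by move=> i; rewrite ler01 lexx.
by left; exact: ltr01.
Defined.

Let Dle z m : D z <= sdist (k z) (k (e m)).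
Proof. by apply: setdist_le => //; exists m. Qed.

Let D0 z : 0 <= D z. Proof. exact: setdist_ge0. Qed.

Let Dlt z x : D z < x -> exists m, sdist (k z) (k (e m)) < x.
Proof.
move=> /(setdist_lt ru (kunit z)) [|_ [m _ <-]]; last by exists m.
by exists (k (e m1)), m1.
Qed.

Let Dgt0 z : ~ range e z -> 0 < D z.
Proof.
move=> ez; rewrite lt_neqAle D0 andbT; apply/negP => /eqP Dz.
have [_ _ _ ce] := eE; apply: ez; apply: ce => V /(uembedding_nbhs ku)[x x0 xV].
have : D z < x by rewrite -Dz.
move=> /Dlt[m mx]; exists (e m); split; first by exists m.
by apply: xV; rewrite sdist_sym.
Qed.

Let Glb z i : lbound (range
  (fun m : model B => m i * D z + sdist (k z) (k (e m)))) (D z).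
Proof.
move=> _ [m _ <-]; apply: le_trans (Dle z m) _; rewrite lerDr mulr_ge0//.
by have /andP[] := mval_unit m i.
Qed.

Let Gle z i (m : model B) : G z i <= m i * D z + sdist (k z) (k (e m)).
Proof. by apply: ge_inf; [exists (D z); exact: Glb|exists m]. Qed.

Let le_G z i x : (forall m : model B, x <= m i * D z + sdist (k z) (k (e m)))
  -> x <= G z i.
Proof.
move=> h; apply: lb_le_inf;
  first by exists (m1 i * D z + sdist (k z) (k (e m1))), m1.
by move=> _ [m _ <-].
Qed.

(** One unit of the constant 2 comes from [D], whose weight [m i] is at most 1, and one from the
    distance to [e m]. The constant does not depend on [i], which gives uniform continuity over the
    coordinates. *)
Let G_lip z w i : G z i <= G w i + 2 * sdist (k z) (k w).
Proof.
rewrite -lerBlDr; apply: le_G => m; rewrite lerBlDr.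
apply: le_trans (Gle z i m) _.
have h1 := @sdist_triangle _ _ (k w) (k z) (k (e m)) (kunit _) (kunit _)
  (kunit _).
have h2 := setdist_lip ru (kunit z) (kunit w); rewrite -/(D _) -/(D _) in h2.
have /andP[m0 m1'] := mval_unit m i; have s0 := sdist_ge0 (kunit z) (kunit w).
have : m i * D z <= m i * (D w + sdist (k z) (k w)) by exact: ler_wpM2l.
have : m i * sdist (k z) (k w) <= sdist (k z) (k w) by rewrite ler_piMl.
by rewrite mulrDr => *; lra.
Qed.

Let ucvg_G z : ucvg (nbhs z) G (G z).
Proof.
move=> x x0; have x2 : 0 < x / 2 by rewrite divr_gt0.
have := uembedding_ball z ku x2; apply: filterS => w /= wz i.
have := G_lip z w i; have := G_lip w z i; rewrite (sdist_sym (k z)) ler_norml.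
by move=> *; apply/andP; split; lra.
Qed.

Let cvg_D z : D w @[w --> z] --> D z.
Proof.
have [_ _ kc] := ku.
exact: (cvg_setdist ru _ kunit (kunit z) ((kc z (nbhs z) _).1 _)).
Qed.

Let fH z i : R := G z i / D z - 1.

(** Every term of the infimum is at least the distance to the range, that is [D z]; a nearly closest
    [m] brings [G z i] down to about [2 * D z], because [m i <= 1]. *)
Let fH_unit z : 0 < D z -> unitf (fH z).
Proof.
move=> Dz i; rewrite /fH lerBrDr lerBlDr add0r ler_pdivlMr// mul1r
  ler_pdivrMr//.
apply/andP; split; first by apply: lb_le_inf;
  [exists (m1 i * D z + sdist (k z) (k (e m1))), m1|exact: Glb].
apply/ler_addgt0Pr => x x0; have : D z < D z + x by rewrite ltrDl.
move=> /Dlt[m mx]; have := Gle z i m; have /andP[m0 m1'] := mval_unit m i.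
have : m i * D z <= D z by rewrite ler_piMl.
by move=> *; lra.
Qed.

(** The maximum with [D] keeps the coordinate s positive off the range of [e], as membership in the
    model demands. Since [D] tends to 0 at the range, continuity there is not affected. *)
Let fr z (i : option I) : R :=
  if i is Some _ then fH z i else maxr (fH z None) (D z).

Let fr_unit z : 0 < D z -> unitf (fr z).
Proof.
move=> Dz [i|]; first exact: fH_unit.
have /andP[h0 h1] := fH_unit Dz None.
by rewrite /fr /= le_max h0 ge_max h1 (setdist_le1 ru).
Qed.

Let rout z (Dz : 0 < D z) : model B.
Proof.
by apply: (@Model R I B (fr z)); split;
  [exact: fr_unit|left; rewrite lt_max Dz orbT].
Defined.

Let r z : model B :=
  match pselect (range e z) with
  | left ez => sval (cid2 ez)
  | right nez => rout (Dgt0 nez)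
  end.

Let re m : r (e m) = m.
Proof.
rewrite /r; case: pselect => [ez|[]]; last by exists m.
by case: cid2 => m' _ /= em; case: eE => inj _ _ _; exact: inj.
Qed.

Let r_out z : ~ range e z -> mval (r z) = fr z.
Proof. by rewrite /r; case: pselect. Qed.

Let r_continuous_out z : ~ range e z -> {for z, continuous r}.
Proof.
move=> nez; apply/cvg_model; rewrite (r_out nez).
have Dz := Dgt0 nez.
have near_out : \forall w \near z, 0 < D w.
  have /cvgrPdist_lt /(_ (D z) Dz) := @cvg_D z; apply: filterS => w;
     have := D0 w; rewrite ltr_norml => ? /andP[]; lra.
have cDV : (D w)^-1 @[w --> z] --> (D z)^-1 by apply: cvgV;
  [rewrite gt_eqF|exact: cvg_D].
have H : ucvg (nbhs z) fH (fH z).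
  have Gb i : `|G z i| <= 2.
    have /andP[] := fH_unit Dz i; rewrite /fH lerBrDr lerBlDr add0r.
    rewrite ler_pdivlMr// mul1r ler_pdivrMr// ler_norml => h1 h2.
    by have := setdist_le1 ru (kunit z); rewrite -/(D z) => ?; apply/andP;
      split; lra.
  have fHE w : fH w = fun i => (D w)^-1 * G w i + - 1.
    by apply/funext => i; rewrite /fH mulrC.
  rewrite (funext fHE); apply: ucvgD; last exact: ucvg_cst.
  exact: ucvgZ Gb cDV _.
have : ucvg (nbhs z) fr (fr z).
  apply: ucvg_option; last exact: (ucvg_comp some H).
  apply: (@cvg_maxr _ _ _ _ (fun t => fH t None) D); last exact: cvg_D.
  exact: (ucvg_at None H).
move=> h; apply: (ucvg_ext _ h); apply: filterS near_out => w Dw.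
rewrite r_out// => -[m _ em]; move: Dw; rewrite /D (setdist_mem ru) ?ltxx//.
by exists m => //=; rewrite em.
Qed.

(** Points [e m] within [2 * D z] of [z] lie within [3 * sdist (k z) (k (e m0))] of [e m0], so [m i]
    is close to [m0 i]. All other [m] contribute more than [2 * D z], too much to lower the infimum.
    The upper bound comes from a nearly closest [m]. *)
Let fH_near (m0 : model B) x (x0 : 0 < x) d (d0 : 0 < d)
    (md : forall m : model B, sdist (k (e m)) (k (e m0)) < d ->
      forall i, `|m i - m0 i| <= x) z :
  x <= 1 -> ~ range e z -> 3 * sdist (k z) (k (e m0)) < d ->
  forall i, `|fH z i - m0 i| <= 2 * x.
Proof.
move=> x1 nez zd i; have Dz := Dgt0 nez.
have tri m := @sdist_triangle _ _ (k z) (k (e m)) (k (e m0)) (kunit _)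
  (kunit _) (kunit _).
have s0 m := sdist_ge0 (kunit z) (kunit (e m)).
have /andP[i0 i1] := mval_unit m0 i; have Dm0 := Dle z m0.
have xD : 0 < x * D z by rewrite mulr_gt0.
rewrite ler_norml /fH; apply/andP; split.
  suff : (m0 i - x + 1) * D z <= G z i by rewrite -ler_pdivlMr// => *; lra.
  apply: le_G => m; have [mD|mD] := leP (sdist (k z) (k (e m))) (2 * D z).
    have := md m; rewrite (le_lt_trans (tri m)) => [|]; last first.
      by rewrite (sdist_sym (k (e m))); have := s0 m0; lra.
    move=> /(_ isT i); rewrite ler_norml => /andP[h _].
    have : (m0 i - x) * D z <= m i * D z by rewrite ler_wpM2r//; lra.
    by have := Dle z m; rewrite !mulrDl mul1r => *; lra.
  have /andP[mi0 _] := mval_unit m i.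
  have : 0 <= m i * D z by rewrite mulr_ge0.
  have : (m0 i - x + 1) * D z <= 2 * D z by rewrite ler_wpM2r//; lra.
  by move=> *; lra.
suff : G z i <= (m0 i + 2 * x + 1) * D z by rewrite -ler_pdivrMr// => *; lra.
have : D z < D z + x * D z by rewrite ltrDl.
move=> /Dlt[m mD]; apply: le_trans (Gle z i m) _.
have := md m; rewrite (le_lt_trans (tri m)) => [|]; last first.
  rewrite (sdist_sym (k (e m))); have := s0 m0.
  have : x * D z <= D z by rewrite ler_piMl// ltW.
  by move=> *; lra.
move=> /(_ isT i); rewrite ler_norml => /andP[_ h].
have : m i * D z <= (m0 i + x) * D z by rewrite ler_wpM2r//; lra.
by rewrite !mulrDl mul1r => *; lra.
Qed.

Let r_continuous_in m0 : {for e m0, continuous r}.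
Proof.
apply/cvg_model; rewrite re => x x0.
have [ei ec eo _] := eE.
pose y := minr 1 (x / 2).
have y0 : 0 < y by rewrite lt_min ltr01 divr_gt0.
have y1 : y <= 1 by rewrite ge_min lexx.
have yx : 2 * y <= x by rewrite /y /minr; case: ltP => ?; lra.
have [d d0 md] : exists2 d, 0 < d &
    forall m : model B, sdist (k (e m)) (k (e m0)) < d ->
      forall i, `|m i - m0 i| <= y.
  (* A ball of the model is turned into the trace of an open subset of [Z]; this is where [e] being
     a topological embedding is used. *)
  have /eo[V oV UV] : open (interior [set m : model B | sdist m m0 < y])
    by exact: open_interior.
  have : nbhs (e m0) V.
    apply: open_nbhs_nbhs; split=> //; rewrite -[V (e m0)]/((e @^-1` V) m0) -UV.
    exact: (uembedding_ball m0 (model_uembedding B) y0).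
  move=> /(uembedding_nbhs ku)[d d0 dV]; exists d => // m /dV.
  rewrite -[V (e m)]/((e @^-1` V) m) -UV => /interior_subset /= mm i.
  by apply: le_trans (ltW mm); apply: sdist_at; exact: mval_unit.
have m0' : 0 < minr y (d / 3) by rewrite lt_min y0 divr_gt0.
have := uembedding_ball (e m0) ku m0'; apply: filterS => z /=.
rewrite lt_min => /andP[zy zd].
have [[m _ emz]|nez] := pselect (range e z).
  rewrite -emz in zy zd *; move=> i; rewrite re; apply: le_trans (_ : y <= x);
    last by lra.
  by apply: md; lra.
have zi := @fH_near m0 y y0 d d0 md z y1 nez _.
have {}zi i : `|fH z i - m0 i| <= 2 * y by apply: zi; lra.
have Dz : D z <= y by rewrite (le_trans (Dle z m0))// ltW.
rewrite r_out// => -[i|] /=; first exact: le_trans (zi _) yx.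
have := zi None; have /andP[] := mval_unit m0 None.
rewrite !ler_norml /maxr => ? ? /andP[? ?].
by apply/andP; case: ltP => ?; split; lra.
Qed.

Lemma model_retraction : exists2 r : Z -> model B, continuous r & cancel e r.
Proof.
exists r; last exact: re.
move=> z; have [[m _ <-]|] := pselect (range e z); first exact: r_continuous_in.
exact: r_continuous_out.
Qed.

End hausdorff_extension.

Lemma model_AR (R : realType) (I : Type) (B : set (I -> R)) :
  absolute_retract R (model B).
Proof.
split; first exact: model_metrizable.
by move=> Z e /metrizable_uembedding[k ku] eE; exact: (model_retraction ku eE).
Qed.

Definition ocons (R I : Type) (a : R) (f : I -> R) (o : option I) : R :=
  if o is Some i then f i else a.

Lemma unitf_ocons (R : realType) (I : Type) (a : R) (f : I -> R) :
  0 <= a <= 1 -> unitf f -> unitf (ocons a f).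
Proof. by move=> a01 fu [i|] //=; exact: fu. Qed.

Lemma ocons_eta (R I : Type) (z : option I -> R) :
  z = ocons (z None) (z \o some).
Proof. by apply/funext => -[]. Qed.

(** * The space as a Z-set of its model *)

Section model_ZsetAR.
Context {R : realType} {X : topologicalType} {I : Type} {e : X -> I -> R}.
Hypothesis eU : uembedding e.

Lemma model_emb_subproof x :
  unitf (ocons 0 (e x)) /\
  (0 < ocons 0 (e x) None \/
   ocons 0 (e x) None = 0 /\ range e (ocons 0 (e x) \o some)).
Proof.
split; first by apply: unitf_ocons; [rewrite lexx ler01|case: eU].
by right; split=> //; exists x.
Qed.

Definition model_emb x : model (range e) := Model (model_emb_subproof x).

Lemma cvg_model_emb (F : set_system X) (FF : Filter F) x :
  model_emb @ F --> model_emb x <-> F --> x.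
Proof.
have [_ _ /(_ x F FF) ->] := eU.
rewrite cvg_model; split=> [/(ucvg_comp some)|h] //.
by apply: ucvg_option => //; exact: cvg_cst.
Qed.

Lemma range_model_emb (m : model (range e)) : range model_emb m <->
  mval m None = 0.
Proof.
split=> [[x _ <-] //|m0]; have [_ [|[_ [x _ ex]]]] := mvalP m.
  by rewrite m0 ltxx.
by exists x => //; apply: mval_inj => /=; rewrite ex -{1}m0 -ocons_eta.
Qed.

Lemma model_emb_closed_embedding : closed_embedding model_emb.
Proof.
split.
- move=> x y /(congr1 (@mval _ _ _)) /= xy; have [_ eI _] := eU; apply: eI.
  by apply/funext => i; have := congr1 (@^~ (Some i)) xy.
- by move=> x; apply/cvg_model_emb.
- move=> U oU; exists (~` closure (model_emb @` ~` U)).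
    by rewrite openC; exact: closed_closure.
  apply/seteqP; split=> [x Ux /= clU|x /= nclU]; last first.
    by apply: contrapT => Ux; apply: nclU; apply: subset_closure; exists x.
  (* Traces outside [U] of the neighbourhoods of [model_emb x]. The image of this filter converges
     to [model_emb x], so the filter itself converges to [x] and contains [U]; hence one of the
     traces must be empty. *)
  pose F := filter_from (nbhs (model_emb x))
    (fun W => model_emb @^-1` W `&` ~` U).
  have FF : Filter F.
    apply: filter_from_filter; first by exists setT; exact: filterT.
    move=> V W xV xW; exists (V `&` W); first exact: filterI.
    by move=> y [[Vy Wy] Uy].
  have /cvg_model_emb : model_emb @ F --> model_emb x.
    by move=> W xW; exists W => // y [].
  move=> /(_ U (open_nbhs_nbhs (conj oU Ux)))[W xW WU].
  have [_ [[y Uy <-] Wy]] := clU _ xW.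
  by apply: (Uy); exact: WU.
- have -> : range model_emb = (fun m : model (range e) => mval m None) @^-1`
    [set 0].
    by apply/seteqP; split=> m /range_model_emb.
  apply: closed_comp => [m _|]; last exact: closed_eq.
  have mm : ucvg (nbhs m) (fun p : model (range e) => mval p) m.
    by apply/cvg_model; exact: cvg_id.
  exact: (ucvg_at None mm).
Qed.

(** The homotopy witnessing the Z-set property raises s to max(s, t): it fixes everything at t = 0
    and leaves the copy of [X] at once. If s stays 0 the point has not moved, so the constraint by
    [range e] persists. *)
Lemma push_subproof (p : model (range e) * unit_interval R) :
  let z := ocons (maxr (mval p.1 None) (set_val p.2)) (mval p.1 \o some) in
  unitf z /\ (0 < z None \/ z None = 0 /\ range e (z \o some)).
Proof.
move: p => [m t] /=; have := set_valP t; rewrite /= in_itv /= => /andP[t0 t1].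
have /andP[m0 m1] := mval_unit m None; split.
  apply: unitf_ocons; first by rewrite le_max t0 orbT ge_max m1.
  by move=> i; exact: mval_unit.
have [tt|tt] := ltP 0 (set_val t); first by left; rewrite lt_max tt orbT.
have -> : maxr (mval m None) (set_val t) = mval m None.
  by apply/max_idPl; exact: le_trans tt m0.
by have [] := mvalP m.
Qed.

Lemma model_Zset : Zset R (range model_emb).
Proof.
split; first by case: model_emb_closed_embedding.
exists (fun p => Model (push_subproof p)); split.
- move=> [m t]; apply/cvg_model => /=.
  have mm : ucvg (nbhs (m, t)) (fun p => mval p.1) m.
    by apply/cvg_model; exact: cvg_fst.
  apply: ucvg_option => /=; last exact: (ucvg_comp some mm).
  apply: cvg_maxr; first exact: (ucvg_at None mm).
  apply: (@cvg_comp _ _ _ snd set_val _ (nbhs t)); first exact: cvg_snd.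
  exact: initial_continuous.
- move=> m; apply: mval_inj => /=; rewrite [RHS]ocons_eta /=; congr ocons.
  by apply/max_idPl; have /andP[] := mval_unit m None.
- by move=> m t t0 /range_model_emb /= h; have := ltxx (0 : R);
    rewrite -{2}h lt_max t0 orbT.
Qed.

Definition model_ZsetAR : ZsetAR R X :=
  MkZsetAR (model_AR (range e)) model_emb_closed_embedding model_Zset.

End model_ZsetAR.

(** * Approaching maps *)

Lemma cvg_set_val (T S : topologicalType) (A : set T) (F : set_system S)
    (FF : Filter F) (f : S -> A) (p : A) :
  f @ F --> p <-> (set_val \o f) @ F --> set_val p.
Proof.
split=> [fp V pV|fp V [_ /= [[W oW <-] Wp WV]]].
  have : nbhs p (set_val @^-1` V) by exact: initial_continuous.
  by move=> /fp.
have /fp : nbhs (set_val p) W by exact: open_nbhs_nbhs.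
by rewrite /nbhs /=; apply: filterS => y; exact: WV.
Qed.

(** All four morphisms are classes of explicit representatives. As these share their ARs, [id]
    serves as comparison map on both sides, and equivalence of representatives follows from an
    approaching homotopy. *)
Lemma fine_shape_equivalent_of_maps (R : realType) (X Y : topologicalType)
    (M : ZsetAR R X) (N : ZsetAR R Y)
    (Phi : ~` Zimage M -> ~` Zimage N) (Psi : ~` Zimage N -> ~` Zimage M) :
  approaching Phi -> approaching Psi ->
  approaching_homotopic R id (Psi \o Phi) ->
  approaching_homotopic R id (Phi \o Psi) ->
  fine_shape_equivalent R X Y.
Proof.
move=> aPhi aPsi hX hY.
pose cls (X' Y' : topologicalType) (P : fs_rep R X' Y') : fs_morphism R X' Y' :=
  MkFsMorphism (ex_intro (fun P0 => forall P', fs_rep_equiv P P' <->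
    fs_rep_equiv P0 P')
    P (fun P' => iff_refl _)).
have combines_id (X' : topologicalType) (M' : ZsetAR R X') :
    combines id (id : ~` Zimage M' -> ~` Zimage M').
  split; first exact: approaching_id.
  by exists id; split=> // x; exact: cvg_id.
have equiv_of_homotopic (X' Y' : topologicalType) (M' : ZsetAR R X')
    (N' : ZsetAR R Y') (f g : ~` Zimage M' -> ~` Zimage N')
    (af : approaching f) (ag : approaching g) :
    approaching_homotopic R f g -> fs_rep_equiv (MkFsRep af) (MkFsRep ag).
  by move=> fg; exists id, id; split; [exact: combines_id..|exact: fg].
have equiv_refl (X' Y' : topologicalType) (M' : ZsetAR R X')
    (N' : ZsetAR R Y') (f : ~` Zimage M' -> ~` Zimage N') (af : approaching f) :
    fs_rep_equiv (MkFsRep af) (MkFsRep af).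
  apply: equiv_of_homotopic.
  have outM (p : ~` (Zimage M' `*` [set: unit_interval R])) :
      (set_val p).1 \in ~` Zimage M'.
    by rewrite inE => Mp; apply: (set_valP p).
  (* The projection of the cylinder; [f \o q] is the constant homotopy that gives reflexivity. *)
  pose q p : ~` Zimage M' := exist _ (set_val p).1 (outM p).
  have aq : approaching q.
    split=> [p|u [[m t] [/= Mm _] mt]].
      apply/(cvg_set_val (nbhs_filter p)).
      have pp : set_val @ nbhs p --> set_val p.
        by apply/(cvg_set_val (nbhs_filter p) id); exact: cvg_id.
      by apply: (cvg_comp _ _ pp); exact: cvg_fst.
    exists m => // V W uV mW.
    have [|[m' t'] /= [Vm Wm]] := mt (fst @^-1` V) (fst @^-1` W) uV.
      by exists (W, setT) => [|[? ?] []] //; split=> //; exact: filterT.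
    by exists m'.
  exists (f \o q); split; first exact: approaching_comp.
    by move=> x; congr f; apply: val_inj.
  by move=> x; congr f; apply: val_inj.
exists (cls _ _ (MkFsRep aPhi)), (cls _ _ (MkFsRep aPsi)), (cls _ _ (rep_id M)),
  (cls _ _ (rep_id N)); split.
- by exists M; exact: equiv_refl.
- by exists N; exact: equiv_refl.
- exists M, N, M, Phi, Psi, aPhi, aPsi; split; [exact: equiv_refl..|].
  exact: equiv_of_homotopic.
- exists N, M, N, Psi, Phi, aPsi, aPhi; split; [exact: equiv_refl..|].
  exact: equiv_of_homotopic.
Qed.

(** A cluster point in [X] of a sequence is the limit of an ultrafilter finer than the sequence, and
    the limit of its image is a cluster point of the image sequence. So limits along ultrafilters
    replace cluster points from here on. *)
Lemma approaching_ultra (M N : topologicalType) (X : set M) (Y : set N)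
    (f : ~` X -> ~` Y) : continuous f ->
  (forall x (U : set_system (~` X)), UltraFilter U -> X x -> set_val @ U -->
    x ->
    exists2 y, Y y & (set_val \o f) @ U --> y) ->
  approaching f.
Proof.
move=> cf fU; split=> // u [x Xx].
rewrite cluster_cvgE => -[G PG [Gx uG]].
(* [G] lives on [M] but contains the range of [set_val], so it pulls back to a proper filter on the
   complement. *)
pose H := filter_from G (fun B => set_val @^-1` B : set (~` X)).
have uH : u @ \oo `<=` H.
  move=> W uW; exists (set_val @` W); last first.
    by move=> p [q Wq /val_inj <-].
  apply: uG; suff : (u @ \oo) (set_val @^-1` (set_val @` W)) by [].
  by apply: filterS uW => p Wp; exists p.
have PH : ProperFilter H.
  apply: filter_from_proper.
    apply: filter_from_filter; first by exists setT; exact: filterT.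
    by move=> B C GB GC; exists (B `&` C) => //; exact: filterI.
  move=> B GB.
  have : G (B `&` range (set_val : ~` X -> M)).
    by apply: filterI => //; apply: uG; exists 0%N => // n _; exists (u n).
  by move=> /filter_ex[_ [/[swap] -[p _ <-] Bp]]; exists p.
have [U [UU HU]] := ultraFilterLemma PH.
have [|y Yy fy] := fU x U UU Xx.
  by move=> V /Gx GV; apply: HU; exists V.
exists y => //; apply: (@cvg_cluster _ ((set_val \o f) @ U)).
  move=> W uW; have {}uW : (u @ \oo) ((set_val \o f) @^-1` W) by [].
  exact: (HU _ (uH _ uW)).
by have := @ultra_cvg_clusterE _ _ (ultra_fmap (set_val \o f) UU) => ->.
Qed.

Lemma fst_continuous (T S : topologicalType) : continuous (@fst T S).
Proof. by move=> p; exact: cvg_fst. Qed.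

Lemma snd_continuous (T S : topologicalType) : continuous (@snd T S).
Proof. by move=> p; exact: cvg_snd. Qed.

(** * Approaching maps given by coordinate formulas *)

Definition inside (R : realType) (I : Type) (z : option I -> R) : Prop :=
  unitf z /\ 0 < z None.

(* The parameter in [0, 1] is that of a homotopy; a map is a constant family. *)
Record coord_approaching (R : realType) (X Y : topologicalType) (I J : Type)
    (e : X -> I -> R) (e' : Y -> J -> R)
    (H : R -> (option I -> R) -> (option J -> R)) : Prop := CoordApproaching {
  coord_inside : forall (t : R) z, 0 <= t <= 1 -> inside z -> inside (H t z);
  coord_cvg : forall (T : Type) (F : set_system T), Filter F ->
    forall (t : T -> R) (t0 : R) w l, (forall i, 0 <= t i <= 1) ->
      0 <= t0 <= 1 ->
    (forall i, inside (w i)) -> inside l ->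
    t x @[x --> F] --> t0 -> ucvg F w l ->
    ucvg F (fun x => H (t x) (w x)) (H t0 l);
  coord_boundary : forall (T : Type) (U : set_system T), UltraFilter U ->
    forall (t : T -> R) (t0 : R) w x, (forall i, 0 <= t i <= 1) ->
      0 <= t0 <= 1 ->
    (forall i, inside (w i)) -> t x @[x --> U] --> t0 ->
    ucvg U w (ocons 0 (e x)) ->
    exists y, ucvg U (fun x => H (t x) (w x)) (ocons 0 (e' y)) }.

Lemma unit_interval01 (R : realType) (t : unit_interval R) :
  0 <= (set_val t : R) <= 1.
Proof. by have := set_valP t; rewrite /= in_itv. Qed.

Section model_complement.
Context {R : realType} {X : topologicalType} {I : Type} {e : X -> I -> R}.
Hypothesis eU : uembedding e.

Notation M := (model_ZsetAR eU).

Lemma out_modelP (m : M) : (m \in ~` Zimage M) <-> 0 < mval m None.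
Proof.
rewrite inE /=; split=> [nm|m0 /(range_model_emb eU) m0'].
  have /andP[m0 _] := mval_unit m None; rewrite lt_neqAle m0 andbT.
  by apply/eqP => /esym /(range_model_emb eU).
by move: m0; rewrite m0' ltxx.
Qed.

Lemma coord_out_subproof z : inside z ->
  unitf z /\ (0 < z None \/ z None = 0 /\ range e (z \o some)).
Proof. by case=> zu z0; split=> //; left. Qed.

Lemma coord_out_out z (zi : inside z) :
  (Model (coord_out_subproof zi) : M) \in ~` Zimage M.
Proof. by apply/out_modelP; case: zi. Qed.

Definition coord_out z (zi : inside z) : ~` Zimage M :=
  exist _ (Model (coord_out_subproof zi) : M) (coord_out_out zi).

Definition coord (q : ~` Zimage M) : option I -> R := mval (set_val q).

Lemma coord_outK z (zi : inside z) : coord (coord_out zi) = z.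
Proof. by []. Qed.

Lemma coord_in q : inside (coord q).
Proof. by split; [exact: mval_unit|apply/out_modelP; case: q]. Qed.

Lemma coord_inj : injective coord.
Proof. by move=> q q' /mval_inj /val_inj. Qed.

Lemma cvg_coord (T : Type) (F : set_system T) (FF : Filter F)
    (f : T -> ~` Zimage M) q :
  (set_val \o f) @ F --> (set_val q : M) <-> ucvg F (coord \o f) (coord q).
Proof. exact: (@cvg_model _ _ _ _ F FF (set_val \o f) (set_val q)). Qed.

Lemma approaching_coord (P : topologicalType) (Z : set P) (f : ~` Z ->
  ~` Zimage M) :
  (forall p, ucvg (nbhs p) (coord \o f) (coord (f p))) ->
  (forall p (U : set_system (~` Z)), UltraFilter U -> Z p -> set_val @ U -->
    p ->
    exists y, ucvg U (coord \o f) (ocons 0 (e y))) ->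
  approaching f.
Proof.
move=> cf bf; apply: approaching_ultra => [p|p U UU Zp Up].
  by apply/(cvg_set_val (nbhs_filter p))/cvg_coord.
have [y fy] := bf p U UU Zp Up; exists (model_emb eU y); first by exists y.
by apply/cvg_model.
Qed.

End model_complement.

Section maps_of_coordinates.
Context {R : realType} {X Y : topologicalType} {I J : Type}.
Context {e : X -> I -> R} {e' : Y -> J -> R}.
Hypotheses (eU : uembedding e) (eU' : uembedding e').
Notation M := (model_ZsetAR eU).
Notation N := (model_ZsetAR eU').

Let zero01 : 0 <= (0 : R) <= 1.
Proof. by rewrite lexx ler01. Qed.

Let fst_out (p : ~` (Zimage M `*` [set: unit_interval R])) :
  (set_val p).1 \in ~` Zimage M.
Proof. by rewrite inE => Mp; apply: (set_valP p). Qed.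

Let pfst p : ~` Zimage M := exist _ (set_val p).1 (fst_out p).

Lemma approaching_of_coord (H : R -> (option I -> R) -> (option J -> R)) :
  coord_approaching e e' H ->
  exists h : ~` (Zimage M `*` [set: unit_interval R]) -> ~` Zimage N,
    approaching h /\
    forall z t, coord (h (cylinder (z, t))) = H (set_val t) (coord z).
Proof.
move=> [Hin Hcvg Hbd].
pose tm (p : ~` (Zimage M `*` [set: unit_interval R])) :=
  set_val (set_val p).2 : R.
pose h p := coord_out eU'
  (Hin (tm p) (coord (pfst p)) (unit_interval01 _) (coord_in _)).
have tcvg (U : set_system (~` (Zimage M `*` [set: unit_interval R])))
    (FU : Filter U) (p : M * unit_interval R) :
    set_val @ U --> p -> tm x @[x --> U] --> set_val p.2.
  move=> Up; have Up2 : (snd \o set_val) @ U --> p.2.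
    by apply: (cvg_comp _ _ Up); exact: (@snd_continuous _ _ p).
  by apply: (cvg_comp _ _ Up2); exact: initial_continuous.
have mcvg (U : set_system (~` (Zimage M `*` [set: unit_interval R])))
    (FU : Filter U) (p : M * unit_interval R) :
    set_val @ U --> p -> ucvg U (fun q => coord (pfst q)) (mval p.1).
  move=> Up; have Up1 : (fst \o set_val) @ U --> p.1.
    by apply: (cvg_comp _ _ Up); exact: (@fst_continuous _ _ p).
  by apply/(@cvg_model _ _ _ _ U FU (fst \o set_val)).
exists h; split; last first.
  by move=> z t; rewrite coord_outK /tm /=; congr (H _ (coord _));
    exact: val_inj.
apply: approaching_coord => [p|p U UU [/= [x _ px] _] Up].
  have pp : set_val @ nbhs p --> set_val p.
    by apply/(cvg_set_val (nbhs_filter p) id); exact: cvg_id.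
  apply: (Hcvg _ _ (nbhs_filter p) tm (tm p) (fun q => coord (pfst q))
    (coord (pfst p))).
  - by move=> q; exact: unit_interval01.
  - exact: unit_interval01.
  - by move=> q; exact: coord_in.
  - exact: coord_in.
  - exact: (tcvg _ (nbhs_filter p)).
  - exact: (mcvg _ (nbhs_filter p)).
have [|||||y yU] := Hbd _ U UU tm (set_val p.2) (fun q => coord (pfst q)) x.
- by move=> q; exact: unit_interval01.
- exact: unit_interval01.
- by move=> q; exact: coord_in.
- exact: tcvg.
- by rewrite -[ocons _ _]/(mval (AR_emb M x)) px; exact: mcvg.
by exists y.
Qed.

Lemma approaching_of_coord_cst (H : (option I -> R) -> (option J -> R)) :
  coord_approaching e e' (fun=> H) ->
  exists h : ~` Zimage M -> ~` Zimage N,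
    approaching h /\ forall z, coord (h z) = H (coord z).
Proof.
move=> [Hin Hcvg Hbd].
pose h (p : ~` Zimage M) := coord_out eU' (Hin 0 (coord p) zero01 (coord_in p)).
exists h; split=> //; apply: approaching_coord => [p|p U UU [x _ px] Up].
  apply: (Hcvg _ _ (nbhs_filter p) (fun=> 0) 0 (@coord _ _ _ _ eU) (coord p))
    => //.
  - exact: coord_in.
  - exact: coord_in.
  - exact: cvg_cst.
  - apply/(cvg_coord (nbhs_filter p) id).
    by apply/(cvg_set_val (nbhs_filter p) id); exact: cvg_id.
have [|||||y yU] := Hbd _ U UU (fun=> 0) 0 (@coord _ _ _ _ eU) x => //.
- exact: coord_in.
- exact: cvg_cst.
- rewrite -px in Up; have FU : Filter U by exact: ultra_proper.
  exact: (@cvg_model _ _ _ _ U FU (fun q : ~` Zimage M => set_val q)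
    (model_emb eU x)).1.
by exists y.
Qed.

End maps_of_coordinates.

(** The common reduction for (a) and (b): it remains to give coordinate formulas for two maps and
    for homotopies from the identities to their composites. *)
Theorem fine_shape_equivalent_coord (R : realType) (X Y : topologicalType)
    (I J : Type) (e : X -> I -> R) (e' : Y -> J -> R) F G HX HY :
  uembedding e -> uembedding e' ->
  coord_approaching e e' (fun=> F) -> coord_approaching e' e (fun=> G) ->
  coord_approaching e e HX -> coord_approaching e' e' HY ->
  (forall z, inside z -> HX 0 z = z /\ HX 1 z = G (F z)) ->
  (forall z, inside z -> HY 0 z = z /\ HY 1 z = F (G z)) ->
  fine_shape_equivalent R X Y.
Proof.
move=> eU eU' /(approaching_of_coord_cst eU eU')[f [af fE]].
move=> /(approaching_of_coord_cst eU' eU)[g [ag gE]].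
move=> /(approaching_of_coord eU eU)[hX [ahX hXE]].
move=> /(approaching_of_coord eU' eU')[hY [ahY hYE]] X01 Y01.
apply: (fine_shape_equivalent_of_maps af ag).
  exists hX; split=> // z; apply: coord_inj; rewrite hXE /=.
    by have [-> _] := X01 _ (coord_in z).
  by have [_ ->] := X01 _ (coord_in z); rewrite gE fE.
exists hY; split=> // z; apply: coord_inj; rewrite hYE /=.
  by have [-> _] := Y01 _ (coord_in z).
by have [_ ->] := Y01 _ (coord_in z); rewrite fE gE.
Qed.

(** * Removing a set from a cylinder *)

Lemma setdist_gt0 (R : realType) (X : topologicalType) (I : Type)
    (k : X -> I -> R) (S : set X) x :
  uembedding k -> nbhs x (~` S) -> 0 < setdist (k @` S) (k x).
Proof.
move=> kU /(uembedding_nbhs kU)[d d0 dS].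
apply: (@lt_le_trans _ _ (minr 1 d)); first by rewrite lt_min ltr01.
apply: lb_le_inf; first by exists 1; left.
move=> _ [->|[_ [y Sy <-] <-]]; first by rewrite ge_min lexx.
rewrite ge_min orbC leNgt; apply/orP; left; apply/negP.
by rewrite sdist_sym => /dS.
Qed.

Section cylinders.
Context {R : realType} {X : topologicalType} {I : Type} {k : X -> I -> R}.
Hypothesis kU : uembedding k.

Let kunit x : unitf (k x).
Proof. by case: kU. Qed.

Let img_unit (S : set X) c : (k @` S) c -> unitf c.
Proof. by move=> [x _ <-]; exact: kunit. Qed.

Definition cyl_coord (P : set (X * unit_interval R)) (p : P) : option I -> R :=
  ocons (set_val (set_val p).2) (k (set_val p).1).

Lemma cyl_coord_uembedding (P : set (X * unit_interval R)) :
  uembedding (@cyl_coord P).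
Proof.
have [_ kI kc] := kU; split.
- by move=> p; apply: unitf_ocons; [exact: unit_interval01|exact: kunit].
- move=> p q pq; apply: val_inj; apply: injective_projections.
    by apply: kI; apply/funext => i; exact: (congr1 (@^~ (Some i)) pq).
  by apply: val_inj; exact: (congr1 (@^~ None) pq).
- move=> p F FF; split=> [Fp|pF].
    have Fp' : set_val @ F --> set_val p by apply/(cvg_set_val FF id).
    have Fp1 : (fst \o set_val) @ F --> (set_val p).1.
      by apply: (cvg_comp _ _ Fp'); exact: (@fst_continuous _ _ (set_val p)).
    have Fp2 : (snd \o set_val) @ F --> (set_val p).2.
      by apply: (cvg_comp _ _ Fp'); exact: (@snd_continuous _ _ (set_val p)).
    apply: ucvg_option => /=; first by move/cvg_set_val: Fp2.
    exact: (kc _ ((fst \o set_val) @ F) _).1.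
  apply/(cvg_set_val FF id).
  have F1 : (fst \o set_val) @ F --> (set_val p).1.
    by apply/kc; exact: (ucvg_comp some pF).
  have F2 : (snd \o set_val) @ F --> (set_val p).2.
    by apply/(cvg_set_val FF); exact: (ucvg_at None pF).
  move=> V [[V1 V2] /= [/F1 V1p /F2 V2p] VV]; rewrite /nbhs /=.
  have {}V1p : F ((fst \o set_val) @^-1` V1) := V1p.
  have {}V2p : F ((snd \o set_val) @^-1` V2) := V2p.
  by apply: filterS2 V1p V2p => q q1 q2; exact: VV.
Qed.

Variable A : set X.
Hypothesis cA : closed A.

Implicit Types z : option (option I) -> R.

Let dA z := setdist (k @` A) (fun i => z (Some (Some i))).
Let dC z := setdist (k @` ~` A) (fun i => z (Some (Some i))).

(* As [s := z None] tends to 0, the factor tends to 1 over the interior of [A],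
   to 0 off [A], and is uncontrolled over the frontier. *)
Let factor z : R := dC z / (dA z + dC z + z None).

(** [c] moves the multiplier of the height r linearly from 1 to [factor]. So [squeeze 1] is the map
    onto the smaller space, [squeeze 0] is induced by the inclusion, and [squeeze] itself is the
    homotopy for both composites. *)
Definition squeeze (c : R) z : option (option I) -> R :=
  ocons (z None) (ocons (z (Some None) * (1 - c + c * factor z))
    (fun i => z (Some (Some i)))).

Lemma squeeze0 z : squeeze 0 z = z.
Proof.
by apply/funext => -[[i|]|] //=; rewrite subr0 mul0r addr0 mulr1.
Qed.

Let tail_unit z : unitf z -> unitf (fun i => z (Some (Some i))).
Proof. by move=> zu i; exact: zu. Qed.

Let dA0 z : unitf z -> 0 <= dA z.
Proof. by move=> zu; apply: (setdist_ge0 (img_unit (S := A)));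
  exact: tail_unit. Qed.

Let dC0 z : unitf z -> 0 <= dC z.
Proof. by move=> zu; apply: (setdist_ge0 (img_unit (S := ~` A)));
  exact: tail_unit. Qed.

Let factor01 z : inside z -> 0 <= factor z <= 1.
Proof.
move=> [zu z0]; have a0 := dA0 zu; have c0 := dC0 zu.
have d0 : 0 < dA z + dC z + z None by rewrite ltr_wpDl// addr_ge0.
by rewrite /factor ler_pdivlMr// ler_pdivrMr// mul0r mul1r c0 /=; lra.
Qed.

Let mix01 (c f : R) : 0 <= c <= 1 -> 0 <= f <= 1 -> 0 <= 1 - c + c * f <= 1.
Proof.
move=> /andP[c0 c1] /andP[f0 f1].
have : c * f <= c by rewrite ler_piMr.
have : 0 <= c * f by rewrite mulr_ge0.
by move=> *; apply/andP; split; lra.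
Qed.

Lemma squeeze_inside c z : 0 <= c <= 1 -> inside z -> inside (squeeze c z).
Proof.
move=> c01 zi; have /andP[m0 m1] := mix01 c01 (factor01 zi).
case: zi => zu z0; split=> // -[[i|]|] /=; [exact: zu| |exact: zu].
have /andP[r0 r1] := zu (Some None).
by rewrite mulr_ge0//= mulr_ile1.
Qed.

Section limits.
Context {T : Type} {F : set_system T} {FF : Filter F}.
Context {w : T -> option (option I) -> R} {l : option (option I) -> R}.
Hypotheses (wi : forall t, inside (w t)) (lu : unitf l) (wl : ucvg F w l).

Lemma cvg_factor : 0 < dA l + dC l + l None -> factor (w t) @[t --> F] -->
  factor l.
Proof.
move=> l0; have wu t : unitf (fun i => w t (Some (Some i)))
  by case: (wi t) => + _ i; exact.
have wl' : ucvg F (fun t i => w t (Some (Some i))) (fun i => l (Some (Some i))).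
  exact: (ucvg_comp (fun i => Some (Some i)) wl).
have aF : dA (w t) @[t --> F] --> dA l.
  exact: (cvg_setdist (img_unit (S := A)) FF wu (tail_unit lu) wl').
have cF : dC (w t) @[t --> F] --> dC l.
  exact: (cvg_setdist (img_unit (S := ~` A)) FF wu (tail_unit lu) wl').
apply: cvgM => //; apply: cvgV; first by rewrite gt_eqF.
by apply: cvgD; [exact: cvgD|exact: (ucvg_at None wl)].
Qed.

Lemma ucvg_squeeze (c : T -> R) (c0 f0 : R) :
  c t @[t --> F] --> c0 -> factor (w t) @[t --> F] --> f0 ->
  ucvg F (fun t => squeeze (c t) (w t))
    (ocons (l None) (ocons (l (Some None) * (1 - c0 + c0 * f0))
      (fun i => l (Some (Some i))))).
Proof.
move=> cc ff; apply: ucvg_option => /=; first exact: (ucvg_at None wl).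
apply: ucvg_option => /=; last exact: (ucvg_comp (fun i => Some (Some i)) wl).
apply: cvgM; first exact: (ucvg_at (Some None) wl).
by apply: cvgD; [apply: cvgB => //; exact: cvg_cst|exact: cvgM].
Qed.

End limits.

(** In the last hypothesis [f] is any possible limit of [factor] over [x]: 1 over the interior, 0
    off [A], arbitrary over the frontier. All resulting limit points must belong to [P']. The
    function [c] will be constant or the identity. *)
Lemma squeeze_approaching (P P' : set (X * unit_interval R)) (c : R -> R) :
  continuous c -> (forall t, 0 <= t <= 1 -> 0 <= c t <= 1) ->
  (forall (t : R) x (r r' : unit_interval R) (f : R), 0 <= t <= 1 -> P (x, r) ->
    0 <= f <= 1 -> (interior A x -> f = 1) -> (~ A x -> f = 0) ->
    set_val r' = set_val r * (1 - c t + c t * f) -> P' (x, r')) ->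
  coord_approaching (@cyl_coord P) (@cyl_coord P') (fun t => squeeze (c t)).
Proof.
move=> cc c01 PP'; split.
- by move=> t z t01 zi; apply: squeeze_inside => //; exact: c01.
- move=> T F FF t t0 w l _ _ wi [lu l0] tt wl.
  apply: ucvg_squeeze => //; first by apply: (cvg_comp _ _ tt); exact: cc.
  by apply: cvg_factor => //; rewrite ltr_wpDl// addr_ge0 ?dA0 ?dC0.
- move=> T U UU t t0 w p _ t01 wi tt wp.
  case: p wp => -[x r] /= pP; rewrite /cyl_coord /= => wp.
  set l := ocons 0 _ in wp.
  have lu : unitf l.
    apply: unitf_ocons; first by rewrite lexx ler01.
    by apply: unitf_ocons; [exact: unit_interval01|exact: kunit].
  have lA : dA l = setdist (k @` A) (k x) by [].
  have lC : dC l = setdist (k @` ~` A) (k x) by [].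
  have [f [f01 ff fA fC]] : exists f : R, [/\ 0 <= f <= 1,
      factor (w t) @[t --> U] --> f, interior A x -> f = 1 & ~ A x -> f = 0].
    have [Ax|nAx] := pselect (interior A x).
      have C0 : 0 < dC l by rewrite lC; apply: setdist_gt0; rewrite // setCK.
      have A0 : dA l = 0.
        rewrite lA; apply: (setdist_mem (img_unit (S := A))) => //.
        by exists x => //; exact: interior_subset.
      exists 1; split; rewrite ?ler01 ?lexx//;
        last by move/(interior_subset): Ax.
      have -> : 1 = factor l by rewrite /factor A0 add0r /= addr0 divff//
        gt_eqF.
      by apply: cvg_factor => //; rewrite A0 add0r /= addr0.
    (* For [x] in [A] but not in its interior no formula gives the limit; compactness of [0, 1]
       provides some [f] along the ultrafilter. *)
    have [Ax|Ax] := pselect (A x).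
      by have [f f01 ff] := ultra_unit_cvg UU (fun t => factor01 (wi t));
        exists f.
    have A0 : 0 < dA l.
      by rewrite lA; apply: setdist_gt0 => //; apply: open_nbhs_nbhs;
        split=> //; exact: closed_openC.
    have C0 : dC l = 0.
      by rewrite lC; apply: (setdist_mem (img_unit (S := ~` A))) => //;
        exists x.
    exists 0; split; rewrite ?ler01 ?lexx//.
    have -> : 0 = factor l by rewrite /factor C0 mul0r.
    by apply: cvg_factor => //; rewrite C0 /= !addr0.
  have cf01 := mix01 (c01 _ t01) f01.
  have r'P : set_val r * (1 - c t0 + c t0 * f) \in (`[0, 1]%classic : set R).
    have /andP[r0 r1] := unit_interval01 r; have /andP[? ?] := cf01.
    by rewrite inE /= in_itv /= mulr_ge0//= mulr_ile1.
  pose r' : unit_interval R := exist _ (set_val r * (1 - c t0 + c t0 * f)) r'P.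
  have xr' : (x, r') \in P'.
    by rewrite inE; apply: (PP' t0 x r r' f) => //; exact: set_mem.
  exists (exist _ (x, r') xr'); rewrite /cyl_coord /=.
  by apply: (ucvg_squeeze wp) => //; apply: (cvg_comp _ _ tt); exact: cc.
Qed.

Lemma cylinder_fine_shape (Q : set (X * unit_interval R)) :
  Q `<=` interior A `*` [set: unit_interval R] ->
  fine_shape_equivalent R
    (set_type (~` Q))
    (set_type ((([set: X] `*` [set I0 R]) `|`
                (A `*` [set: unit_interval R])) `\` Q)).
Proof.
move=> QA; set Y := _ `\` Q.
(* Two reasons keep limits out of [Q]: over the interior of [A] the height is unchanged in the limit
   ([val_r]), and elsewhere the whole fibre misses [Q] ([nQ]). *)
have nQ x r : ~ interior A x -> ~ Q (x, r) by move=> nx /QA[].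
have val_r (r r' : unit_interval R) (f : R) : f = 1 ->
  set_val r' = set_val r * f -> r' = r.
  by move=> ->; rewrite mulr1 => /val_inj.
have XX : forall c : R -> R, continuous c ->
  (forall t, 0 <= t <= 1 -> 0 <= c t <= 1) ->
    coord_approaching (@cyl_coord (~` Q)) (@cyl_coord (~` Q))
      (fun t => squeeze (c t)).
  move=> c cc c01; apply: squeeze_approaching =>
    // t x r r' f t01 Qr f01 fA _ rr'.
  have [Ax|nAx] := pselect (interior A x); last exact: nQ.
  by rewrite (val_r r r' _ _ rr')// fA// mulr1 subrK.
have YY : forall c : R -> R, continuous c ->
  (forall t, 0 <= t <= 1 -> 0 <= c t <= 1) ->
    coord_approaching (@cyl_coord Y) (@cyl_coord Y) (fun t => squeeze (c t)).
  move=> c cc c01; apply: squeeze_approaching =>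
    // t x r r' f t01 [Yr Qr] f01 fA _ rr'.
  have [Ax|nAx] := pselect (interior A x).
    by rewrite (val_r r r' _ _ rr')// fA// mulr1 subrK.
  split; last exact: nQ.
  case: Yr => [[_ /= r0]|[Ax _]]; [left; split=> //=|by right].
  by apply: val_inj; rewrite -[LHS]/(set_val r') rr' r0 /= mul0r.
have YX : coord_approaching (@cyl_coord Y) (@cyl_coord (~` Q))
  (fun=> squeeze 0).
  apply: (@squeeze_approaching _ _ (fun=> 0)) =>
    [x|t _|t x r r' f _ [_ Qr] _ _ _ rr'].
  - exact: cvg_cst.
  - by rewrite lexx ler01.
  - by rewrite (val_r r r' _ _ rr')// subr0 mul0r addr0.
have XY : coord_approaching (@cyl_coord (~` Q)) (@cyl_coord Y)
  (fun=> squeeze 1).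
  apply: (@squeeze_approaching _ _ (fun=> 1)) =>
    [x|t _|t x r r' f _ Qr _ fA fC rr'].
  - exact: cvg_cst.
  - by rewrite lexx ler01.
  have [Ax|nAx] := pselect (interior A x).
    rewrite (val_r r r' _ _ rr'); last by rewrite fA// mulr1 subrK.
    by split=> //; right; split=> //; exact: interior_subset.
  split; last exact: nQ.
  have [Ax|nA] := pselect (A x); [by right|left; split=> //=].
  by apply: val_inj; rewrite -[LHS]/(set_val r') rr' fC// mulr0 addr0 subrr
    mulr0.
apply: (@fine_shape_equivalent_coord R _ _ _ _ _ _ (squeeze 1) (squeeze 0)
  squeeze squeeze).
- exact: cyl_coord_uembedding.
- exact: cyl_coord_uembedding.
- exact: XY.
- exact: YX.
- exact: (XX id (fun x => cvg_id)).
- exact: (YY id (fun x => cvg_id)).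
- by move=> z _; rewrite !squeeze0.
- by move=> z _; rewrite !squeeze0.
Qed.

End cylinders.

(** * Collapsing a compact set *)

Section quotient_embedding.
Context {R : realType} {T : topologicalType} (r : T -> T -> Prop).

Lemma quotient_by_piP x y :
  quotient_by_pi r x = quotient_by_pi r y <-> clos_refl_sym_trans T r x y.
Proof.
split=> [/(@eqmodP _ (gen_equiv r)) /asboolP //|xy].
by apply/(@eqmodP _ (gen_equiv r))/asboolP.
Qed.

Lemma quotient_by_reprK (q : quotient_by r) : quotient_by_pi r (repr q) = q.
Proof. exact: reprK. Qed.

Lemma quotient_by_pi_continuous : continuous (quotient_by_pi r).
Proof. exact: pi_continuous. Qed.

Context {I : Type} (g : T -> I -> R).
Hypotheses (gu : forall x, unitf (g x)) (gc : forall x, ucvg (nbhs x) g (g x))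
  (gr : forall x y, r x y -> g x = g y).

Lemma quotient_by_repr x : g (repr (quotient_by_pi r x)) = g x.
Proof.
have clos_g y z : clos_refl_sym_trans T r y z -> g y = g z.
  by elim=> [? ? /gr||? ? _ ->|? ? ? _ -> _ ->].
exact/clos_g/quotient_by_piP/quotient_by_reprK.
Qed.

(** Uniform convergence at [q] amounts to continuity of the real function [phi], the distance to
    [g (repr q)]. Being constant on classes, it descends to the quotient topology. *)
Lemma quotient_by_ucvg (q : quotient_by r) :
  ucvg (nbhs q) (fun q : quotient_by r => g (repr q)) (g (repr q)).
Proof.
pose phi x := sdist (g x) (g (repr q)).
have phic : continuous phi.
  move=> x; have /(ucvg_sdist _ gu (gu x)) /cvgrPdist_le gx := gc x.
  apply/cvgrPdist_le => e /gx; apply: filterS => y.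
  rewrite sub0r normrN ger0_norm ?sdist_ge0// => xy; rewrite ler_norml /phi.
  have := sdist_triangle (gu y) (gu x) (gu (repr q)).
  have := sdist_triangle (gu x) (gu y) (gu (repr q)).
  by rewrite (sdist_sym (g x) (g y)) => *; apply/andP; split; lra.
have : continuous (phi \o repr : quotient_by r -> R).
  apply: repr_comp_continuous phic _ => x y /eqP xy.
  have {}xy : quotient_by_pi r x = quotient_by_pi r y by exact: xy.
  by rewrite /phi -(quotient_by_repr x) xy quotient_by_repr.
move=> /(_ q); rewrite /continuous_at /= {2}/phi (sdistxx (gu _)) => h.
by apply/(ucvg_sdist _ _ (gu (repr q))).
Qed.

(** An ultrafilter on the quotient is lifted by [repr]; the last hypothesis gives the lift a limit
    in [T], which the quotient map carries back to [q]. The limit need not be the chosen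
    representative of [q]. *)
Lemma quotient_uembedding :
  (forall x y, g x = g y -> clos_refl_sym_trans T r x y) ->
  (forall x (U : set_system T), UltraFilter U -> ucvg U g (g x) ->
    exists y : T, U --> y) ->
  uembedding (fun q : quotient_by r => g (repr q)).
Proof.
move=> gI gU; apply: ultra_uembedding =>
  [//|q q' /gI /quotient_by_piP||q U UU Uq].
- by rewrite !quotient_by_reprK.
- exact: quotient_by_ucvg.
have [y Uy] := gU (repr q) _ (ultra_fmap repr UU) Uq.
have yq : quotient_by_pi r y = q.
  rewrite -(quotient_by_reprK q); apply/quotient_by_piP/gI.
  have PU := @ultra_proper _ _ (ultra_fmap repr UU).
  exact: (@ucvg_unique _ _ _ (repr @ U) g _ _ PU (ucvg_sub Uy (gc y)) Uq).
move=> V; rewrite -{1}yq => /quotient_by_pi_continuous /Uy.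
by rewrite /nbhs /=; apply: filterS => q' /=; rewrite quotient_by_reprK.
Qed.

End quotient_embedding.

Section collapse_and_cone.
Context {R : realType} {X : topologicalType} {I : Type} {k : X -> I -> R}.
Hypothesis kU : uembedding k.
Variable A : set X.
Hypotheses (cA : closed A) (kA : compact A).

Let kunit x : unitf (k x). Proof. by case: kU. Qed.

Let img_unit (S : set X) c : (k @` S) c -> unitf c.
Proof. by move=> [x _ <-]; exact: kunit. Qed.

Definition distA x : R := setdist (k @` A) (k x).

Lemma distA01 x : 0 <= distA x <= 1.
Proof.
by rewrite (setdist_ge0 (img_unit (S := A)))//
  (setdist_le1 (img_unit (S := A))).
Qed.

Lemma distA_eq0 x : A x -> distA x = 0.
Proof. by move=> Ax; apply: (setdist_mem (img_unit (S := A))) => //; exists x.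
  Qed.

Lemma distA_gt0 x : ~ A x -> 0 < distA x.
Proof.
move=> Ax; apply: setdist_gt0 => //; apply: open_nbhs_nbhs; split=> //.
exact: closed_openC.
Qed.

Lemma cvg_distA (T : Type) (F : set_system T) (FF : Filter F) (xs : T -> X) x :
  ucvg F (k \o xs) (k x) -> distA (xs t) @[t --> F] --> distA x.
Proof. exact: (cvg_setdist (img_unit (S := A)) FF (fun t => kunit (xs t))). Qed.

(** Each point gets a companion in [A] within twice its distance to [A]; the factor 2 allows for a
    distance that is not attained. The companions converge by compactness of [A], and the points
    follow them. *)
Lemma ultra_cvg_A (T : Type) (U : set_system T) (xs : T -> X) : UltraFilter U ->
  A !=set0 -> distA (xs t) @[t --> U] --> 0 ->
  exists2 b, A b & xs @ U --> b.
Proof.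
move=> UU [b0 Ab0] xs0.
have /choice[b bP] : forall x, exists b,
  A b /\ sdist (k x) (k b) <= 2 * distA x.
  move=> x; have [Ax|Ax] := pselect (A x).
    by exists x; split; rewrite // distA_eq0// sdistxx// mulr0.
  have x2 : setdist (k @` A) (k x) < 2 * distA x.
    by have := distA_gt0 Ax; rewrite -/(distA x) => ?; lra.
  have A0 : (k @` A) !=set0 by exists (k b0); exists b0.
  have [_ [b Ab <-] bx] := setdist_lt (img_unit (S := A)) (kunit x) A0 x2.
  by exists b; split=> //; exact: ltW.
have := kA; rewrite compact_ultra => /(_ _ (ultra_fmap (b \o xs) UU)).
case=> [|y [Ay bxy]].
  suff : U ((b \o xs) @^-1` A) by [].
  by apply: nearW => t; have [] := bP (xs t).
exists y => //; have [_ _ kc] := kU; apply/(kc y (xs @ U)).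
apply/(@ucvg_sdist _ _ _ U _ (k \o xs) _ (fun t => kunit (xs t)) (kunit y)).
have /(@ucvg_sdist _ _ _ U _ _ _ (fun t => kunit (b (xs t))) (kunit y)) bk :
    ucvg U (k \o (b \o xs)) (k y) by exact: (kc y ((b \o xs) @ U) _).1.
have xb : 2 * distA (xs t) + sdist (k (b (xs t))) (k y) @[t --> U] -->
  (2 * 0 + 0 : R).
  by apply: cvgD => //; apply: cvgM => //; exact: cvg_cst.
rewrite mulr0 addr0 in xb.
have c0 : (fun=> 0 : R) @ U --> (0 : R) by exact: cvg_cst.
apply: (squeeze_cvgr _ c0 xb).
apply: nearW => t; rewrite sdist_ge0//=.
have [_ bx] := bP (xs t).
apply: le_trans (sdist_triangle _ (kunit (b (xs t))) _) _ => //.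
by rewrite lerD2r.
Qed.

Definition collapse_point x : option I -> R :=
  ocons (distA x) (fun i => distA x * k x i).

Definition collapse_coord (q : collapse A) : option I -> R :=
  collapse_point (repr q).

Let collapse_point_cvg x : ucvg (nbhs x) collapse_point (collapse_point x).
Proof.
have [_ _ kc] := kU; have kx : ucvg (nbhs x) k (k x)
  by exact: (kc x (nbhs x) _).1.
have dx : distA y @[y --> x] --> distA x
  by exact: (cvg_distA (nbhs_filter x) kx).
apply: ucvg_option => //=; apply: (ucvgZ (b := 1)) => // i.
by have /andP[? ?] := kunit x i; rewrite ger0_norm.
Qed.

Let collapse_pointE x y : A x -> A y -> collapse_point x = collapse_point y.
Proof.
move=> Ax Ay; apply/funext => -[i|] /=; rewrite !distA_eq0//.
by rewrite !mul0r.
Qed.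

Lemma collapse_point_unit x : unitf (collapse_point x).
Proof.
have /andP[d0 d1] := distA01 x.
move=> [i|] /=; last exact: distA01.
by have /andP[? ?] := kunit x i; rewrite mulr_ge0//= mulr_ile1.
Qed.

Lemma range_collapse_coord : range collapse_coord = range collapse_point.
Proof.
apply/seteqP; split=> [_ [q _ <-]|_ [x _ <-]]; first by exists (repr q).
exists (quotient_by_pi _ x) => //; apply: quotient_by_repr => y z [].
exact: collapse_pointE.
Qed.

(** Multiplication by the distance to [A] sends all of [A] to 0 and can be undone off [A]. For
    limits this leaves two cases: division by the distance off [A], and compactness of [A] at the
    collapsed point. *)
Lemma collapse_uembedding : uembedding collapse_coord.
Proof.
apply: quotient_uembedding.
- exact: collapse_point_unit.
- exact: collapse_point_cvg.
- by move=> x y [Ax Ay]; exact: collapse_pointE.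
- move=> x y xy; have dxy : distA x = distA y by exact: (congr1 (@^~ None) xy).
  have [Ax|Ax] := pselect (A x).
    apply: rst_step; split=> //; apply: contrapT => /distA_gt0.
    by rewrite -dxy distA_eq0// ltxx.
  have dx := distA_gt0 Ax; have [_ kI _] := kU.
  suff -> : x = y by exact: rst_refl.
  apply: kI; apply/funext => i; have := congr1 (@^~ (Some i)) xy.
  by rewrite /= -dxy => /mulfI; apply; rewrite gt_eqF.
- move=> x U UU Ux; have [_ _ kc] := kU.
  have dU : distA y @[y --> U] --> distA x by exact: (ucvg_at None Ux).
  have [Ax|Ax] := pselect (A x).
    rewrite (distA_eq0 Ax) in dU.
    have [|b Ab Ub] := @ultra_cvg_A _ U id UU _ dU; first by exists x.
    by exists b.
  have dx := distA_gt0 Ax; exists x; apply/kc.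
  have dV : (distA y)^-1 @[y --> U] --> (distA x)^-1 by apply: cvgV;
    rewrite ?gt_eqF.
  have d1 i : `|distA x * k x i| <= 1.
    by have /andP[? ?] := collapse_point_unit x (Some i); rewrite ger0_norm.
  have kxE : k x = fun i => (distA x)^-1 * (distA x * k x i).
    by apply/funext => i; rewrite mulKf// gt_eqF.
  have h : ucvg U (fun y i => (distA y)^-1 * collapse_point y (Some i)) (k x).
    by rewrite {1}kxE; apply: ucvgZ d1 dV (ucvg_comp some Ux).
  apply: ucvg_ext h.
  have /cvgrPdist_lt /(_ _ dx) := dU; apply: filterS => y;
    rewrite ltr_norml => /andP[_ yx].
  by apply/funext => i; rewrite /= mulKf// gt_eqF//; lra.
Qed.

End collapse_and_cone.

(** * Attaching a cone *)

Section attached_cone.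
Context {R : realType} {X : topologicalType} {I : Type} {k : X -> I -> R}.
Hypothesis kU : uembedding k.
Variable A : set X.
Hypotheses (cA : closed A) (kA : compact A).

Let kunit x : unitf (k x). Proof. by case: kU. Qed.

Let knorm x i : `|k x i| <= 1.
Proof. by have /andP[? ?] := kunit x i; rewrite ger0_norm. Qed.

Notation dist_A := (distA (k := k) A).

Definition base_point x : option (option I) -> R :=
  ocons (dist_A x) (ocons 1 (k x)).

(* [c] is the height measured from the vertex, so [c = 1 - t]. *)
Definition scaled_point x (c : R) : option (option I) -> R :=
  ocons 0 (ocons c (fun i => c * k x i)).

Definition cone_pt (p : A * unit_interval R) : option (option I) -> R :=
  scaled_point (set_val p.1) (1 - set_val p.2).

Definition attach_pt (s : disjoint_sum X (cone R A)) : option (option I) -> R :=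
  match s with
  | existT b y =>
    match b return summand X (cone R A) b -> option (option I) -> R with
    | true => base_point
    | false => fun q => cone_pt (repr q)
    end y
  end.

Definition attach_coord (q : attach_cone R A) : option (option I) -> R :=
  attach_pt (repr q).

Lemma scaled_point_unit x (c : R) : 0 <= c <= 1 -> unitf (scaled_point x c).
Proof.
move=> /andP[c0 c1]; apply: unitf_ocons; first by rewrite lexx ler01.
apply: unitf_ocons; first by rewrite c0.
by move=> i; have /andP[? ?] := kunit x i; rewrite mulr_ge0//= mulr_ile1.
Qed.

Lemma base_point_unit x : unitf (base_point x).
Proof.
by apply: unitf_ocons; [exact: distA01|apply: unitf_ocons => //;
  rewrite ler01 lexx].
Qed.

Let onem01 (t : unit_interval R) : 0 <= 1 - set_val t <= (1 : R).
Proof. by have /andP[? ?] := unit_interval01 t; apply/andP; split; lra. Qed.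

Lemma scaled_point1 x : A x -> scaled_point x 1 = base_point x.
Proof.
move=> Ax; apply/funext => -[[i|]|] //=; first by rewrite mul1r.
by rewrite (distA_eq0 kU).
Qed.

Let cone_ptE (p q : A * unit_interval R) : p.2 = I1 R /\ q.2 = I1 R ->
  cone_pt p = cone_pt q.
Proof.
case: p q => [a t] [b u] /= [-> ->]; rewrite /cone_pt /scaled_point /= subrr.
by apply/funext => -[[i|]|] //=; rewrite !mul0r.
Qed.

Let cone_ptK (p : A * unit_interval R) :
  cone_pt (repr (cone_point p)) = cone_pt p.
Proof. exact: (quotient_by_repr (g := cone_pt) cone_ptE). Qed.

Lemma cone_pt_eq (p q : A * unit_interval R) :
  cone_pt p = cone_pt q -> cone_point p = cone_point q.
Proof.
case: p q => [a t] [b u] pq; apply/quotient_by_piP.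
have tu : t = u.
  have := congr1 (@^~ (Some None)) pq; rewrite /= => h; apply: val_inj.
  by rewrite -[val t]/(set_val t : R) -[val u]/(set_val u : R); lra.
have [t1|t1] := eqVneq (set_val t : R) 1.
  have t1' : t = I1 R by exact: val_inj.
  by apply: rst_step; rewrite /= -tu t1'.
suff -> : a = b by rewrite tu; exact: rst_refl.
have [_ kI _] := kU; apply: val_inj; apply: kI; apply/funext => i.
have := congr1 (@^~ (Some (Some i))) pq; rewrite /= -tu => /mulfI; apply.
by rewrite subr_eq0 eq_sym.
Qed.

Let cone_pt_cvg p : ucvg (nbhs p) cone_pt (cone_pt p).
Proof.
have [_ _ kc] := kU.
have kp : ucvg (nbhs p) (fun q : A * unit_interval R => k (set_val q.1))
  (k (set_val p.1)).
  apply: (kc _ ((set_val \o fst) @ nbhs p) _).1.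
  by apply/(cvg_set_val (nbhs_filter p)); exact: (@fst_continuous _ _ p).
have tp : 1 - set_val q.2 @[q --> p] --> (1 - set_val p.2 : R).
  apply: cvgB; first exact: cvg_cst.
  by apply/(cvg_set_val (nbhs_filter p)); exact: (@snd_continuous _ _ p).
apply: ucvg_option; first exact: cvg_cst.
by apply: ucvg_option => //=; apply: ucvgZ (knorm _) tp kp.
Qed.

Let attach_rel (u v : disjoint_sum X (cone R A)) := exists a : A,
  u = in_left _ (set_val a) /\ v = in_right _ (cone_point (a, I0 R)).

Let attach_ptE u v : attach_rel u v -> attach_pt u = attach_pt v.
Proof.
move=> [a [-> ->]] /=; rewrite cone_ptK /cone_pt /= subr0 scaled_point1//.
exact: set_valP.
Qed.

Let attach_pt_unit s : unitf (attach_pt s).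
Proof.
case: s => -[] y /=; first exact: base_point_unit.
by apply: scaled_point_unit; exact: onem01.
Qed.

Let base_point_cvg (T : Type) (F : set_system T) (FF : Filter F) (xs : T -> X)
  x :
  ucvg F (k \o xs) (k x) -> ucvg F (base_point \o xs) (base_point x).
Proof.
move=> kx; apply: ucvg_option; first exact: (cvg_distA kU).
by apply: ucvg_option => //; exact: cvg_cst.
Qed.

Let attach_pt_cvg s : ucvg (nbhs s) attach_pt (attach_pt s).
Proof.
have [_ _ kc] := kU; case: s => -[] y.
  have kx : ucvg (nbhs y) k (k y) by exact: (kc y (nbhs y) _).1.
  exact: (base_point_cvg (xs := id) _ kx).
apply: (quotient_by_ucvg (g := cone_pt) _ cone_pt_cvg cone_ptE).
by move=> p; apply: scaled_point_unit; exact: onem01.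
Qed.

(** The last clause concerns the base of the cone, whose points are the only ones of the cone to
    share coordinates with points of [X]. *)
Let attach_pt_right q : exists a (c : R), [/\ A a, 0 <= c <= 1,
  attach_pt (in_right _ q) = scaled_point a c &
  c = 1 -> attach_rel (in_left _ a) (in_right _ q)].
Proof.
exists (set_val (repr q).1), (1 - set_val (repr q).2); split.
- exact: set_valP.
- exact: onem01.
- by [].
- move=> c1; exists (repr q).1; split=> //; congr in_right.
  have -> : I0 R = (repr q).2 by apply: val_inj;
    rewrite -[RHS]/(set_val (repr q).2 : R) /=; lra.
  by rewrite -surjective_pairing; apply/esym/quotient_by_reprK.
Qed.

Lemma attach_coordP q : (exists x, attach_coord q = base_point x) \/
  (exists a (c : R), [/\ A a, 0 <= c <= 1 & attach_coord q = scaled_point a c]).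
Proof.
rewrite /attach_coord; case: (repr q) => -[] y; first by left; exists y.
by right; have [a [c [Aa c01 -> _]]] := attach_pt_right y; exists a, c.
Qed.

Lemma attach_coord_base x : exists q, attach_coord q = base_point x.
Proof.
exists (quotient_by_pi _ (in_left (cone R A) x)).
exact: (quotient_by_repr attach_ptE).
Qed.

Lemma attach_coord_scaled a (c : R) : A a -> 0 <= c <= 1 ->
  exists q, attach_coord q = scaled_point a c.
Proof.
move=> Aa c01.
have c'P : 1 - c \in (`[0, 1]%classic : set R).
  by rewrite inE /= in_itv /=; lra.
pose t : unit_interval R := exist _ (1 - c) c'P.
pose p : A * unit_interval R := (exist _ a (mem_set Aa), t).
exists (quotient_by_pi _ (in_right X (cone_point p))).
rewrite /attach_coord (quotient_by_repr attach_ptE) /= cone_ptK /cone_pt /=.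
by rewrite subKr.
Qed.

(** An ultrafilter on the disjoint sum lives on one summand. On [X] the coordinates contain [k]
    itself, which controls convergence; on the cone a limit exists by compactness of A * I alone. *)
Lemma attach_uembedding : uembedding attach_coord.
Proof.
have [_ kI kc] := kU.
apply: quotient_uembedding => //.
- have left_right x q : attach_pt (in_left _ x) = attach_pt (in_right _ q) ->
      attach_rel (in_left _ x) (in_right _ q).
    have [a [c [Aa _ -> c1]]] := attach_pt_right q => xq.
    have c1' : c = 1 by exact: (esym (congr1 (@^~ (Some None)) xq)).
    have -> : x = a; last exact: c1.
    apply: kI; apply/funext => i; have := congr1 (@^~ (Some (Some i))) xq.
    by rewrite /= c1' mul1r.
  move=> [[] x] [[] y] xy.
  + suff -> : x = y by exact: rst_refl.
    by apply: kI; apply/funext => i; exact: (congr1 (@^~ (Some (Some i))) xy).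
  + by apply: rst_step; exact: left_right.
  + by apply: rst_sym; apply: rst_step; apply: left_right; exact: esym.
  + suff -> : x = y by exact: rst_refl.
    by have := cone_pt_eq xy; rewrite /cone_point !quotient_by_reprK.
- move=> s U UU Us.
  have [UL|UL] := in_ultra_setVsetC
    [set s : disjoint_sum X (cone R A) | projT1 s] UU.
    have [x0 _] : exists x : X, True.
      by have [[[] x] //= _] := filter_ex UL; exists x.
    pose lft (s : disjoint_sum X (cone R A)) : X :=
      match s with
      | existT b y => match b return summand X (cone R A) b -> X with
        | true => id | false => fun=> x0 end y
      end.
    have lftE (s' : disjoint_sum X (cone R A)) : projT1 s' ->
      s' = in_left _ (lft s') by case: s' => -[].
    (* The second coordinate is constantly 1 on [X], so a limit value taken on the cone belongs to
       its base, hence to a point of [A]. *)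
    have [x sx] : exists x, attach_pt s = base_point x.
      case: s Us => -[] y Us; first by exists y.
      have [a [c [Aa _ yac _]]] := attach_pt_right y.
      exists a; rewrite -scaled_point1// [LHS]yac; congr scaled_point.
      rewrite -[existT _ _ _]/(in_right _ y) yac in Us.
      have Uc : attach_pt t (Some None) @[t --> U] --> c
        by exact: (ucvg_at (Some None) Us).
      have U1 : attach_pt t (Some None) @[t --> U] --> (1 : R).
        by apply: cvg_near_cst; apply: filterS UL => t /lftE ->.
      exact: (cvg_unique (@Rhausdorff R) Uc U1).
    exists (in_left _ x) => V xV.
    have : (lft @ U) (fun y => V (in_left _ y)).
      apply: (kc x (lft @ U) _).2 => //; rewrite sx in Us.
      suff h : ucvg U (k \o lft) (k x) by exact: h.
      apply: ucvg_ext (ucvg_comp (fun i => Some (Some i)) Us).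
      by apply: filterS UL => t /lftE {1}->.
    move=> UV; have {}UV : U (fun t => V (in_left (cone R A) (lft t))) := UV.
    by apply: filterS2 UL UV => t /lftE {2}->.
  have [q0 _] : exists q : cone R A, True.
    by have [[[] q] //= _] := filter_ex UL; exists q.
  pose rgt (s : disjoint_sum X (cone R A)) : cone R A :=
    match s with
    | existT b y => match b return summand X (cone R A) b -> cone R A with
      | true => fun=> q0 | false => id end y
    end.
  have rgtE (s' : disjoint_sum X (cone R A)) : ~ projT1 s' ->
    s' = in_right _ (rgt s') by case: s' => -[].
  pose aU (s' : disjoint_sum X (cone R A)) := set_val (repr (rgt s')).1 : X.
  have := kA; rewrite compact_ultra => /(_ _ (ultra_fmap aU UU)).
  case=> [|a [Aa aUa]].
    suff : U (aU @^-1` A) by [].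
    by apply: nearW => s'; exact: set_valP.
  have := ultra_unit_cvg UU (fun s' => unit_interval01 (repr (rgt s')).2).
  move=> [t t01 Ut]; have tP : t \in (`[0, 1]%classic : set R)
    by rewrite inE /= in_itv.
  pose p : A * unit_interval R := (exist _ a (mem_set Aa), exist _ t tP).
  exists (in_right X (cone_point p)) => V pV.
  have : nbhs (cone_point p) (fun y => V (in_right X y)) by exact: pV.
  move=> /quotient_by_pi_continuous [[V1 V2] /= [V1a V2t] VV].
  have U1 : (fun s' => (repr (rgt s')).1) @ U --> p.1 by apply/(cvg_set_val _).
  have U2 : (fun s' => (repr (rgt s')).2) @ U --> p.2 by apply/(cvg_set_val _).
  have W1 : U ((fun s' => (repr (rgt s')).1) @^-1` V1) := U1 _ V1a.
  have W2 : U ((fun s' => (repr (rgt s')).2) @^-1` V2) := U2 _ V2t.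
  apply: filterS3 UL W1 W2 => s' /rgtE {3}-> r1 r2.
  rewrite -(quotient_by_reprK (rgt s')).
  by have := VV (repr (rgt s')) (conj r1 r2).
Qed.

End attached_cone.

(** * Comparing the quotient with the attached cone *)

(** Here [w] need not converge: a bounded factor is harmless when the scalar tends to 0. *)
Lemma ucvg0Z (R : realType) (T I : Type) (F : set_system T) (FF : Filter F)
    (c : T -> R) (w : T -> I -> R) :
  (forall t, unitf (w t)) -> c t @[t --> F] --> (0 : R) ->
  ucvg F (fun t i => c t * w t i) (fun=> 0).
Proof.
move=> wu /cvgrPdist_le c0 e /c0; apply: filterS => t.
rewrite sub0r normrN => ct i; rewrite subr0 normrM.
have /andP[? ?] := wu t i; rewrite -[leRHS]mulr1 ler_pM//.
by rewrite ger0_norm.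
Qed.

Section height.
Context {R : realType}.
Implicit Types D a s : R.

(** Designed to be positive only where D + s < a^2, to equal 1 at D = s = 0 for a > 0, and to be
    continuous except at a = s = 0, which is the collapsed point. *)
Definition height D a s : R := maxr 0 (a ^+ 2 - D - s) / maxr (a ^+ 2) s.

Lemma height01 D a s : 0 <= D -> 0 < s -> 0 <= height D a s <= 1.
Proof.
move=> D0 s0; have m0 : 0 < maxr (a ^+ 2) s by rewrite lt_max s0 orbT.
rewrite /height; apply/andP; split.
  by apply: divr_ge0; [rewrite le_max lexx|exact: ltW].
have a2 := sqr_ge0 a; rewrite ler_pdivrMr// mul1r ge_max !le_max a2 /=.
by apply/orP; left; lra.
Qed.

Lemma height_gt0 D a s : 0 < s -> 0 < height D a s -> D + s < a ^+ 2.
Proof.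
move=> s0; have m0 : 0 < maxr (a ^+ 2) s by rewrite lt_max s0 orbT.
by rewrite /height pmulr_lgt0 ?invr_gt0// lt_max ltxx /= => ?; lra.
Qed.

Lemma height1 a : 0 < a -> height 0 a 0 = 1.
Proof.
move=> a0; have a2 : 0 < a ^+ 2 by rewrite exprn_gt0.
rewrite /height !subr0 (max_idPr (ltW a2)) (max_idPl (ltW a2)) divff//.
by rewrite gt_eqF.
Qed.

Lemma cvg_height (T : Type) (F : set_system T) (FF : Filter F) (D a s : T -> R)
    (D0 a0 s0 : R) : 0 < maxr (a0 ^+ 2) s0 ->
  D t @[t --> F] --> D0 -> a t @[t --> F] --> a0 -> s t @[t --> F] --> s0 ->
  height (D t) (a t) (s t) @[t --> F] --> height D0 a0 s0.
Proof.
move=> m0 DF aF sF; have a2 : a t ^+ 2 @[t --> F] --> a0 ^+ 2 by exact: cvgM.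
apply: cvgM.
  by apply: cvg_maxr; [exact: cvg_cst|apply: cvgB => //; exact: cvgB].
by apply: cvgV; [rewrite gt_eqF|exact: cvg_maxr].
Qed.

End height.

Section collapse_attach.
Context {R : realType} {X : topologicalType} {I : Type} {k : X -> I -> R}.
Hypothesis kU : uembedding k.
Variable A : set X.
Hypotheses (cA : closed A) (kA : compact A).

Let kunit x : unitf (k x). Proof. by case: kU. Qed.

Let knorm x i : `|k x i| <= 1.
Proof. by have /andP[? ?] := kunit x i; rewrite ger0_norm. Qed.

Notation dist_A := (distA (k := k) A).
Notation eC := (collapse_coord (k := k) (A := A)).
Notation eA := (attach_coord (k := k) (A := A)).
Notation pC := (collapse_point (k := k) A).
Notation pB := (base_point (k := k) A).
Notation pS := (scaled_point (k := k)).

Let pC_unit c : range pC c -> unitf c.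
Proof. by move=> [x _ <-]; exact: collapse_point_unit. Qed.

(** The term a (1 - c) vanishes on [X], where c = 1, and on the cone, where a = 0, so raising s to
    it does not disturb the limits. Its purpose is to make the height of the image vanish near cone
    points with c < 1. *)
Definition attach_to_collapse (z : option (option (option I)) -> R) :
  option (option I) -> R :=
  ocons (maxr (z None) (z (Some None) * (1 - z (Some (Some None)))))
    (ocons (z (Some None)) (fun i => z (Some None) * z (Some (Some (Some i))))).

Let Dist (z : option (option I) -> R) := setdist (range pC) (z \o some).

Let hgt (z : option (option I) -> R) :=
  height (Dist z) (z (Some None)) (z None).

(** At (a, a k) with a > 0 and s <= a this is k. The minimum keeps the quotient in [0, 1] at other
    points, and the maximum keeps the denominator positive. *)
Let dir (z : option (option I) -> R) i :=
  minr (z (Some (Some i))) (z (Some None)) / maxr (z (Some None)) (z None).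

Definition collapse_to_attach (z : option (option I) -> R) :
  option (option (option I)) -> R :=
  ocons (z None) (ocons (z (Some None))
    (ocons (hgt z) (fun i => hgt z * dir z i))).

Notation F := attach_to_collapse.
Notation G := collapse_to_attach.

Let Dist_ge0 z : unitf z -> 0 <= Dist z.
Proof. by move=> zu; apply: (setdist_ge0 pC_unit) => i; exact: zu. Qed.

Let hgt01 z : inside z -> 0 <= hgt z <= 1.
Proof. by move=> [zu z0]; apply: height01 => //; exact: Dist_ge0. Qed.

Let dir_unit z : inside z -> unitf (dir z).
Proof.
move=> [zu z0] i; have m0 : 0 < maxr (z (Some None)) (z None)
  by rewrite lt_max z0 orbT.
have /andP[a0 _] := zu (Some None); have /andP[v0 _] := zu (Some (Some i)).
rewrite /dir ler_pdivlMr// ler_pdivrMr// mul0r mul1r le_min v0 a0 /=.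
by rewrite ge_min !le_max lexx orbT.
Qed.

Lemma attach_to_collapse_inside z : inside z -> inside (F z).
Proof.
move=> [zu z0]; split; last by rewrite /= lt_max z0.
have /andP[s0 s1] := zu None; have /andP[a0 a1] := zu (Some None).
have /andP[c0 c1] := zu (Some (Some None)).
move=> [[i|]|] /=; [|by rewrite a0|]; last first.
  by rewrite le_max s0 ge_max s1 /= mulr_ile1// ?subr_ge0// lerBlDr lerDl.
by have /andP[u0 u1] := zu (Some (Some (Some i)));
  rewrite mulr_ge0//= mulr_ile1.
Qed.

Lemma collapse_to_attach_inside z : inside z -> inside (G z).
Proof.
move=> zi; have /andP[h0 h1] := hgt01 zi; have du := dir_unit zi;
  case: zi => zu z0.
split=> // -[[[i|]|]|] /=; [|by rewrite h0|exact: zu|exact: zu].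
by have /andP[? ?] := du i; rewrite mulr_ge0//= mulr_ile1.
Qed.

Section limits.
Context {T : Type} {U : set_system T} {FU : Filter U}.

Lemma ucvg_attach_to_collapse (w : T -> option (option (option I)) -> R) l :
  unitf l -> ucvg U w l -> ucvg U (F \o w) (F l).
Proof.
move=> lu wl.
have aU : w t (Some None) @[t --> U] --> l (Some None)
  by exact: (ucvg_at (Some None) wl).
apply: ucvg_option => /=.
  apply: cvg_maxr; first exact: (ucvg_at None wl).
  apply: cvgM => //; apply: cvgB; first exact: cvg_cst.
  exact: (ucvg_at (Some (Some None)) wl).
apply: ucvg_option => //=; apply: (ucvgZ (b := 1)) => //.
  by move=> i; have /andP[? ?] := lu (Some (Some (Some i))); rewrite ger0_norm.
exact: (ucvg_comp (fun i => Some (Some (Some i))) wl).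
Qed.

(** The positivity condition excludes only a = s = 0, the collapsed point, which
    [collapse_to_attach_limit_A] treats separately; elsewhere the denominators have positive
    limits. *)
Lemma ucvg_collapse_to_attach (w : T -> option (option I) -> R) l :
  (forall t, inside (w t)) -> unitf l ->
    0 < maxr (l (Some None) ^+ 2) (l None) ->
  ucvg U w l -> ucvg U (G \o w) (G l).
Proof.
move=> wi lu m0 wl.
have aU : w t (Some None) @[t --> U] --> l (Some None)
  by exact: (ucvg_at (Some None) wl).
have sU : w t None @[t --> U] --> l None by exact: (ucvg_at None wl).
have /andP[a0 a1] := lu (Some None); have /andP[s0 s1] := lu None.
have m0' : 0 < maxr (l (Some None)) (l None).
  move: m0; rewrite !lt_max => /orP[|->]; last by rewrite orbT.
  by move=> h; rewrite lt_neqAle a0 andbT; case: eqP h => // <-;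
    rewrite expr0n ltxx.
have wl' : ucvg U (fun t => w t \o some) (l \o some)
  by exact: (ucvg_comp some wl).
have hU : hgt (w t) @[t --> U] --> hgt l.
  apply: cvg_height => //; apply: (cvg_setdist pC_unit FU) => //.
    by move=> t i; have [wu _] := wi t; exact: wu.
  by move=> i; exact: lu.
apply: ucvg_option => //=; apply: ucvg_option => //=; apply: ucvg_option => //=.
have dl i : `|dir l i| <= 1.
  have /andP[v0 v1] := lu (Some (Some i)).
  rewrite ger0_norm; last by apply: divr_ge0; [rewrite le_min v0|exact: ltW].
  by rewrite ler_pdivrMr// mul1r ge_min !le_max lexx orbT.
apply: ucvgZ dl hU _.
have mV : (maxr (w t (Some None)) (w t None))^-1 @[t --> U] -->
    (maxr (l (Some None)) (l None))^-1.
  by apply: cvgV; [rewrite gt_eqF|exact: cvg_maxr].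
have v1 i : `|minr (l (Some (Some i))) (l (Some None))| <= 1.
  have /andP[v0 v1] := lu (Some (Some i)).
  by rewrite ger0_norm ?le_min ?v0// ge_min v1.
have wl2 : ucvg U (fun t i => w t (Some (Some i))) (fun i => l (Some (Some i))).
  exact: (ucvg_comp (fun i => Some (Some i)) wl).
have dirE (z : option (option I) -> R) : dir z = fun i =>
    (maxr (z (Some None)) (z None))^-1 * minr (z (Some (Some i)))
      (z (Some None)).
  by apply/funext => i; rewrite mulrC.
rewrite (funext (fun t => dirE (w t))) dirE; apply: ucvgZ v1 mV _.
exact: ucvg_min wl2 aU.
Qed.

Lemma ucvg_mix (J : Type) (t : T -> R) (t0 : R) (w w' : T -> J -> R) l l' :
  unitf l -> unitf l' -> t x @[x --> U] --> t0 -> ucvg U w l -> ucvg U w' l' ->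
  ucvg U (fun x i => (1 - t x) * w x i + t x * w' x i)
    (fun i => (1 - t0) * l i + t0 * l' i).
Proof.
move=> lu lu' tt wl wl'.
have b (f : J -> R) : unitf f -> forall i, `|f i| <= 1.
  by move=> fu i; have /andP[? ?] := fu i; rewrite ger0_norm.
apply: ucvgD; last exact: ucvgZ (b _ lu') tt wl'.
by apply: ucvgZ (b _ lu) _ wl; apply: cvgB => //; exact: cvg_cst.
Qed.

Lemma attach_to_collapse_base x : F (ocons 0 (pB x)) = ocons 0 (pC x).
Proof.
by apply/funext => -[[i|]|] //=; rewrite subrr mulr0 (max_idPl (lexx 0)).
Qed.

Lemma attach_to_collapse_scaled a c : A a ->
  F (ocons 0 (pS a c)) = ocons 0 (pC a).
Proof.
move=> Aa; have a0 := distA_eq0 kU Aa.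
apply/funext => -[[i|]|] //=; rewrite ?a0 ?mul0r//.
exact: (max_idPl (lexx 0)).
Qed.

Lemma collapse_to_attach_base x : 0 < dist_A x ->
  G (ocons 0 (pC x)) = ocons 0 (pB x).
Proof.
move=> x0; have h1 : hgt (ocons 0 (pC x)) = 1.
  rewrite /hgt /= (_ : Dist _ = 0) ?height1//.
  by apply: (setdist_mem pC_unit); [exact: collapse_point_unit|exists x].
apply/funext => -[[[i|]|]|] //=; rewrite h1 // mul1r /dir /=.
have /andP[k0 k1] := kunit x i.
rewrite (max_idPl (ltW x0)) (min_idPl _) ?ler_piMr ?(ltW x0)//.
by rewrite mulrAC divff ?mul1r// gt_eqF.
Qed.

Lemma collapse_to_attach_limit_base w x : (forall t, inside (w t)) ->
  0 < dist_A x ->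
  ucvg U w (ocons 0 (pC x)) -> ucvg U (G \o w) (ocons 0 (pB x)).
Proof.
move=> wi x0 wx; rewrite -collapse_to_attach_base//.
apply: ucvg_collapse_to_attach => //.
  by apply: unitf_ocons; [rewrite lexx ler01|exact: collapse_point_unit].
by rewrite /= lt_max exprn_gt0.
Qed.

(** Every coordinate of [F (G z)] is built from s and multiples of a by bounded quantities. All tend
    to 0, whatever the height and the direction do. *)
Lemma round_trip_limit_A w x : (forall t, inside (w t)) -> A x ->
  ucvg U w (ocons 0 (pC x)) -> ucvg U (F \o G \o w) (ocons 0 (pC x)).
Proof.
move=> wi Ax wx; have x0 := distA_eq0 kU Ax.
have sU : w t None @[t --> U] --> (0 : R) by exact: (ucvg_at None wx).
have aU : w t (Some None) @[t --> U] --> (0 : R).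
  by rewrite -[0]x0; exact: (ucvg_at (Some None) wx).
have Gu t : unitf (G (w t)) by case: (collapse_to_attach_inside (wi t)).
apply: ucvg_option => /=.
  rewrite -[X in _ --> X](max_idPl (lexx 0)); apply: cvg_maxr => //.
  have h : ucvg U (fun t (_ : unit) => w t (Some None) * (1 - hgt (w t)))
    (fun=> 0).
    apply: ucvg0Z => // t _; have /andP[? ?] := hgt01 (wi t).
    by apply/andP; split; lra.
  exact: (ucvg_at tt h).
apply: ucvg_option => /=; first by rewrite x0.
have -> : (fun i => dist_A x * k x i) = (fun=> 0).
  by apply/funext => i; rewrite x0 mul0r.
by apply: ucvg0Z => // t i; exact: (Gu t (Some (Some (Some i)))).
Qed.

End limits.

(** Along the ultrafilter the height has a limit c. If c = 0 the limit is the vertex and the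
    direction is irrelevant; otherwise the direction is asymptotic to [k] at points of [X] that tend
    to [A]. *)
Lemma collapse_to_attach_limit_A (T : Type) (U : set_system T) w x :
  UltraFilter U -> (forall t : T, inside (w t)) -> A x ->
  ucvg U w (ocons 0 (pC x)) ->
  exists b (c : R), [/\ A b, 0 <= c <= 1 & ucvg U (G \o w) (ocons 0 (pS b c))].
Proof.
move=> UU wi Ax wx; have x0 := distA_eq0 kU Ax.
have sU : w t None @[t --> U] --> (0 : R) by exact: (ucvg_at None wx).
have aU : w t (Some None) @[t --> U] --> (0 : R).
  by rewrite -[0]x0; exact: (ucvg_at (Some None) wx).
have [c c01 cU] := ultra_unit_cvg UU (fun t => hgt01 (wi t)).
have du t : unitf (dir (w t)) by exact: dir_unit.
suff [b Ab bU] : exists2 b, A b &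
    ucvg U (fun t i => hgt (w t) * dir (w t) i) (fun i => c * k b i).
  exists b, c; split=> //; apply: ucvg_option => //=.
  by apply: ucvg_option => //=; apply: ucvg_option.
have [c0|c0] := eqVneq c 0.
  exists x => //; rewrite (_ : (fun i => c * k x i) = (fun=> 0)); last first.
    by apply/funext => i; rewrite c0 mul0r.
  by apply: ucvg0Z => //; rewrite -c0.
have {}c0 : 0 < c by rewrite lt_neqAle eq_sym c0; case/andP: c01.
(* Where the height is positive, [w t] is so close to a point of [X / A] that
   the direction determines this point up to an error [2 a]. *)
have /choice[xs xsP] : forall t, exists y, 0 < hgt (w t) ->
    sdist (w t \o some) (pC y) < w t (Some None) ^+ 2.
  move=> t; have [h0|h0] := pselect (0 < hgt (w t)); last by exists x.
  have [wu w0] := wi t; have wu' : unitf (w t \o some) by move=> i; exact: wu.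
  have P0 : range pC !=set0 by exists (pC x), x.
  have Dt : Dist (w t) < w t (Some None) ^+ 2.
    by have := height_gt0 w0 h0; lra.
  have [_ [y _ <-] ty] := setdist_lt pC_unit wu' P0 Dt.
  by exists y.
have near_pos : \forall t \near U, 0 < hgt (w t).
  have /cvgrPdist_lt /(_ _ c0) := cU; apply: filterS => t.
  by rewrite ltr_norml => /andP[_ ?]; lra.
have a2U : w t (Some None) + w t (Some None) @[t --> U] --> (0 : R).
  by rewrite -[X in _ --> X]addr0; exact: cvgD.
have c0U : (fun=> 0 : R) @ U --> (0 : R) by exact: cvg_cst.
(* With v the coordinate of [w t] and d the distance to [A], both |v - d k| and |(d - a) k| are at
   most a^2, so dividing by a gives the error 2a. Truncating v at a does no harm because a k <=
   a. *)
have xsE : \forall t \near U,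
  [/\ dist_A (xs t) <= w t (Some None) + w t (Some None) &
    forall i, `|dir (w t) i - k (xs t) i| <= w t (Some None) + w t (Some None)].
  move: near_pos; apply: filterS => t ht.
  have [wu w0] := wi t; have wu' : unitf (w t \o some) by move=> i; exact: wu.
  have Ds := height_gt0 w0 ht; have D0 := Dist_ge0 wu.
  have /andP[a0 a1] := wu (Some None).
  set a := w t (Some None) in a0 a1 Ds *; set s := w t None in w0 Ds *.
  have near_xs j : `|w t (Some j) - pC (xs t) j| <= a ^+ 2.
    apply: le_trans (ltW (xsP t ht)).
    exact: (sdist_at j wu' (collapse_point_unit kU A (xs t))).
  have a2 : a ^+ 2 <= a by rewrite expr2 ler_piMr.
  have sa : s < a by lra.
  have apos : 0 < a by lra.
  have := near_xs None; rewrite /= ler_norml => /andP[d1 d2].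
  split=> [|i]; first by rewrite -/a in d1 d2; lra.
  have := near_xs (Some i); rewrite /dir /= -/a -/s (max_idPl (ltW sa)).
  have /andP[k0 k1] := kunit (xs t) i.
  set d := dist_A (xs t) in d1 d2 *; set v := w t (Some (Some i)).
  rewrite ler_norml => /andP[v1 v2].
  have ak : a * k (xs t) i <= a by rewrite ler_piMr// ltW.
  have dk : `|(d - a) * k (xs t) i| <= a ^+ 2.
    rewrite normrM -[leRHS]mulr1; apply: ler_pM => //.
    by rewrite -/a in d1 d2; rewrite ler_norml; apply/andP; split; lra.
  move: dk; rewrite ler_norml mulrBl => /andP[dk1 dk2].
  rewrite -[k (xs t) i](mulfK (lt0r_neq0 apos)) -mulrBl normrM.
  rewrite [X in _ * X]gtr0_norm ?invr_gt0// ler_pdivrMr// mulrDl -expr2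
    (mulrC (k _ _)).
  by rewrite ler_norml /minr; apply/andP; case: ltP => ?; split; lra.
have dxs : dist_A (xs t) @[t --> U] --> (0 : R).
  apply: (squeeze_cvgr _ c0U a2U); apply: filterS xsE => t [-> _].
  by have /andP[->] := distA01 kU A (xs t).
have [|b Ab bU] := @ultra_cvg_A _ _ _ _ kU _ cA kA _ U xs UU _ dxs;
  first by exists x.
exists b => //; apply: ucvgZ (knorm b) cU _.
have [_ _ kc] := kU.
have xb : ucvg U (k \o xs) (k b) by exact: (kc b (xs @ U) _).1.
have dU : ucvg U (fun t i => dir (w t) i - k (xs t) i) (fun=> 0).
  move=> e e0; have /cvgrPdist_lt /(_ e e0) := a2U; apply: filterS2 xsE.
  move=> t [_ h]; rewrite sub0r normrN => te i; rewrite subr0.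
  by apply: le_trans (h i) _; rewrite (le_trans (ler_norm _))// ltW.
have h : ucvg U (fun t i => dir (w t) i - k (xs t) i + k (xs t) i)
  (fun i => 0 + k b i).
  exact: ucvgD dU xb.
move: h; rewrite (_ : (fun i => 0 + k b i) = k b); last first.
  by apply/funext => i; rewrite add0r.
by apply: ucvg_ext; apply: nearW => t; apply/funext => i; rewrite subrK.
Qed.

(* The height is corrected by the term [t h (1 - c)] so as to end at [h]. The
   correction tends to 0 at the cone, where either [c = 1] or [h] tends to 0. *)
Definition slide (t : R) (z : option (option (option I)) -> R) :=
  let h := G (F z) (Some (Some None)) in
  ocons ((1 - t) * z None + t * F z None)
    (ocons (z (Some None))
      (ocons ((1 - t + t * h) * z (Some (Some None)) + t * h *
        (1 - z (Some (Some None))))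
        (fun i => (1 - t + t * h) * z (Some (Some (Some i)))))).

(** A straight segment suffices on this side: its two ends tend to the same point of the quotient,
    so every intermediate point does too. *)
Definition mix (t : R) (z : option (option I) -> R) o :=
  (1 - t) * z o + t * F (G z) o.

Lemma slide0 z : slide 0 z = z.
Proof.
by apply/funext => -[[[i|]|]|] //=; rewrite !(subr0, mul0r, addr0, mul1r).
Qed.

(** Where the height vanishes the direction is multiplied by 0. Where it is positive, s < a, so the
    truncations in [dir] are inactive and division by a recovers the original coordinate. *)
Lemma slide1 z : inside z -> slide 1 z = G (F z).
Proof.
move=> zi; have [zu z0] := zi; apply/funext => -[[[i|]|]|] //=.
- rewrite subrr mul1r add0r.
  have [Fu F0] := attach_to_collapse_inside zi.
  have := hgt01 (conj Fu F0) => /andP[h0 _].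
  have [->|hn] := eqVneq (hgt (F z)) 0; first by rewrite !mul0r.
  have {hn}h0' : 0 < hgt (F z) by rewrite lt_neqAle eq_sym hn.
  have := height_gt0 F0 h0'; have := Dist_ge0 Fu => D0 Ds.
  have /andP[a0 a1] := zu (Some None); have /andP[u0 u1] :=
    zu (Some (Some (Some i))).
  have aa : z (Some None) ^+ 2 <= z (Some None) by rewrite expr2 ler_piMr.
  have sa : F z None < z (Some None) by move: Ds; rewrite [F z (Some None)]/=;
    lra.
  have apos : 0 < z (Some None) by exact: lt_trans F0 sa.
  congr (_ * _); rewrite /dir [F z (Some None)]/= (max_idPl (ltW sa)) /=.
  by rewrite (min_idPl _) ?ler_piMr// mulrAC divff ?mul1r// gt_eqF.
- by rewrite subrr; ring.
- by rewrite subrr mul0r add0r mul1r.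
Qed.

Lemma mix0 z : mix 0 z = z.
Proof. by apply/funext => o; rewrite /mix subr0 mul1r mul0r addr0. Qed.

Lemma mix1 z : mix 1 z = F (G z).
Proof. by apply/funext => o; rewrite /mix subrr mul1r mul0r add0r. Qed.

Let conv01 (t x y : R) : 0 <= t <= 1 -> 0 <= x <= 1 -> 0 <= y <= 1 ->
  0 <= (1 - t) * x + t * y <= 1.
Proof.
move=> /andP[t0 t1] /andP[x0 x1] /andP[y0 y1].
have : t * y <= t by rewrite ler_piMr.
have : (1 - t) * x <= 1 - t by rewrite ler_piMr// subr_ge0.
have : 0 <= t * y by rewrite mulr_ge0.
have : 0 <= (1 - t) * x by rewrite mulr_ge0// subr_ge0.
by move=> *; apply/andP; split; lra.
Qed.

Let conv_gt0 (t x y : R) : 0 <= t <= 1 -> 0 < x -> 0 < y ->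
  0 < (1 - t) * x + t * y.
Proof.
move=> /andP[t0 t1] x0 y0; have [->|tn] := eqVneq t 1.
  by rewrite subrr mul0r add0r mul1r.
rewrite ltr_wpDr ?mulr_ge0// ?(ltW y0)// mulr_gt0// subr_gt0.
by rewrite lt_neqAle tn.
Qed.

Lemma mix_inside t z : 0 <= t <= 1 -> inside z -> inside (mix t z).
Proof.
move=> t01 zi; have [FGu FG0] :=
  attach_to_collapse_inside (collapse_to_attach_inside zi).
case: zi => zu z0; split; last exact: conv_gt0.
by move=> o; apply: conv01.
Qed.

Lemma slide_inside t z : 0 <= t <= 1 -> inside z -> inside (slide t z).
Proof.
move=> t01 zi; have Fi := attach_to_collapse_inside zi; have [Fu F0] := Fi.
have [Gu _] := collapse_to_attach_inside Fi.
have [zu z0] := zi; split; last exact: (conv_gt0 t01 z0 F0).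
have /andP[h0 h1] := Gu (Some (Some None)).
have /andP[c0 c1] := zu (Some (Some None)).
have /andP[t0 t1] := t01.
rewrite /= in h0 h1; set h := hgt (F z) in h0 h1.
have th0 : 0 <= t * h by rewrite mulr_ge0.
have th1 : t * h <= t by rewrite ler_piMr.
move=> [[[i|]|]|]; rewrite /= -/h;
  [| |exact: zu|exact: (conv01 t01 (zu None) (Fu None))].
- have /andP[u0 u1] := zu (Some (Some (Some i))).
  by apply/andP; split; [apply: mulr_ge0|apply: mulr_ile1] => //; lra.
- have p0 : 0 <= (1 - t + t * h) * z (Some (Some None)) by rewrite mulr_ge0//;
    lra.
  have q0 : 0 <= t * h * (1 - z (Some (Some None))) by rewrite mulr_ge0//; lra.
  have p1 : (1 - t) * z (Some (Some None)) <= 1 - t by rewrite ler_piMr//; lra.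
  by rewrite addr_ge0//=; rewrite mulrDl mulrBr mulr1 in p0 q0 *; lra.
Qed.

(** * The approaching conditions for the two maps and the two homotopies *)

Lemma attach_to_collapse_approaching : coord_approaching eA eC (fun=> F).
Proof.
split.
- by move=> t z _; exact: attach_to_collapse_inside.
- by move=> T U FU t t0 w l _ _ _ [lu _] _; exact: ucvg_attach_to_collapse.
- move=> T U UU t t0 w q _ _ wi _ wq.
  have [x Fx] : exists x, F (ocons 0 (eA q)) = ocons 0 (pC x).
    have [[x ->]|[a [c [Aa _ ->]]]] := attach_coordP (k := k) q.
      by exists x; exact: attach_to_collapse_base.
    by exists a; exact: attach_to_collapse_scaled.
  have [q' _ q'x] : range eC (pC x) by rewrite range_collapse_coord//; exists x.
  exists q'; rewrite q'x -Fx; apply: ucvg_attach_to_collapse wq.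
  apply: unitf_ocons; first by rewrite lexx ler01.
  by have [eu _ _] := attach_uembedding kU kA.
Qed.

Let eC_point q : exists x, eC q = pC x.
Proof.
have : range eC (eC q) by exists q.
by rewrite range_collapse_coord// => -[x _ <-]; exists x.
Qed.

Lemma collapse_to_attach_approaching : coord_approaching eC eA (fun=> G).
Proof.
split.
- by move=> t z _; exact: collapse_to_attach_inside.
- move=> T U FU t t0 w l _ _ wi [lu l0] _; apply: ucvg_collapse_to_attach => //.
  by rewrite lt_max l0 orbT.
- move=> T U UU t t0 w q _ _ wi _ wq; have [x qx] := eC_point q.
  rewrite {}qx in wq; have [Ax|Ax] := pselect (A x).
    have [b [c [Ab c01 Gw]]] := collapse_to_attach_limit_A UU wi Ax wq.
    have [q' q'E] := attach_coord_scaled kU Ab c01.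
    by exists q'; rewrite q'E.
  have [q' q'E] := attach_coord_base kU A x; exists q'; rewrite q'E.
  apply: collapse_to_attach_limit_base => //; exact: (distA_gt0 kU).
Qed.

Let comp_cvg_FG (T : Type) (U : set_system T) (FU : Filter U) w l :
  (forall x : T, inside (w x)) -> inside l -> ucvg U w l ->
  ucvg U (F \o G \o w) (F (G l)).
Proof.
move=> wi li wl; have [Gu _] := collapse_to_attach_inside li.
apply: ucvg_attach_to_collapse => //; apply: ucvg_collapse_to_attach => //.
  by case: li.
by case: li => _ l0; rewrite lt_max l0 orbT.
Qed.

Lemma mix_approaching : coord_approaching eC eC mix.
Proof.
split; first exact: mix_inside.
- move=> T U FU t t0 w l _ _ wi li tt wl.
  have [FGu _] := attach_to_collapse_inside (collapse_to_attach_inside li).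
  by apply: ucvg_mix => //; [case: li|exact: comp_cvg_FG].
- move=> T U UU t t0 w q _ _ wi tt wq; exists q; have [x qx] := eC_point q.
  rewrite {}qx in wq *; set l := ocons 0 _ in wq *.
  have lu : unitf l.
    by apply: unitf_ocons; [rewrite lexx ler01|exact: collapse_point_unit].
  have FGl : ucvg U (F \o G \o w) l.
    have [Ax|Ax] := pselect (A x); first exact: round_trip_limit_A.
    rewrite /l -attach_to_collapse_base; apply: ucvg_attach_to_collapse.
      by apply: unitf_ocons; [rewrite lexx ler01|exact: base_point_unit].
    by apply: collapse_to_attach_limit_base => //; exact: (distA_gt0 kU).
  have -> : l = fun o => (1 - t0) * l o + t0 * l o.
    by apply/funext => o; rewrite -mulrDl subrK mul1r.
  exact: ucvg_mix.
Qed.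

(** The limits [h0] and [s0] are separate data because at a cone point the height is not determined
    by [l]; there its limit exists only along an ultrafilter. *)
Let slide_limit (T : Type) (U : set_system T) (FU : Filter U) w l (t : T -> R)
    (t0 h0 s0 : R) : unitf l -> t x @[x --> U] --> t0 -> ucvg U w l ->
  G (F (w x)) (Some (Some None)) @[x --> U] --> h0 ->
  F (w x) None @[x --> U] --> s0 ->
  ucvg U (fun x => slide (t x) (w x))
    (ocons ((1 - t0) * l None + t0 * s0)
      (ocons (l (Some None))
        (ocons ((1 - t0 + t0 * h0) * l (Some (Some None)) +
            t0 * h0 * (1 - l (Some (Some None))))
          (fun i => (1 - t0 + t0 * h0) * l (Some (Some (Some i))))))).
Proof.
move=> lu tt wl hh ss.
have cU : w x (Some (Some None)) @[x --> U] --> l (Some (Some None)).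
  exact: (ucvg_at (Some (Some None)) wl).
have c1 : (fun=> 1 : R) @ U --> (1 : R) by exact: cvg_cst.
have th : t x * G (F (w x)) (Some (Some None)) @[x --> U] --> t0 * h0
  by exact: cvgM.
have mm : 1 - t x + t x * G (F (w x)) (Some (Some None)) @[x --> U] -->
  1 - t0 + t0 * h0.
  by apply: cvgD => //; exact: cvgB.
apply: ucvg_option => /=.
  by apply: cvgD; apply: cvgM => //; [exact: cvgB|exact: (ucvg_at None wl)].
apply: ucvg_option => /=; first exact: (ucvg_at (Some None) wl).
apply: ucvg_option => /=.
  by apply: cvgD; apply: cvgM => //; exact: cvgB.
apply: (ucvgZ (b := 1)) mm _.
  by move=> i; have /andP[? ?] := lu (Some (Some (Some i))); rewrite ger0_norm.
exact: (ucvg_comp (fun i => Some (Some (Some i))) wl).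
Qed.

(** Once the correction term disappears, the height and the direction coordinates are scaled by the
    same factor, so the limit stays on the segment of the cone over [a]. *)
Lemma slide_limit_scaled (T : Type) (U : set_system T) w a (c : R) (t : T -> R)
  (t0 : R) :
  UltraFilter U -> (forall x, inside (w x)) -> A a -> 0 <= c <= 1 ->
    0 <= t0 <= 1 ->
  t x @[x --> U] --> t0 -> ucvg U w (ocons 0 (pS a c)) ->
  exists2 c' : R, 0 <= c' <= 1 &
    ucvg U (fun x => slide (t x) (w x)) (ocons 0 (pS a c')).
Proof.
move=> UU wi Aa c01 t01 tt wl.
have lu : unitf (ocons 0 (pS a c)).
  by apply: unitf_ocons; [rewrite lexx ler01|exact: scaled_point_unit].
have Fi x := attach_to_collapse_inside (wi x).
have Gu x : unitf (G (F (w x))) by case: (collapse_to_attach_inside (Fi x)).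
have [h h01 hh] := ultra_unit_cvg UU (fun x => Gu x (Some (Some None))).
have Fl : ucvg U (F \o w) (F (ocons 0 (pS a c)))
  by exact: ucvg_attach_to_collapse.
have s0 : F (w x) None @[x --> U] --> (0 : R).
  by move: Fl; rewrite attach_to_collapse_scaled// => Fl;
    exact: (ucvg_at None Fl).
have aU : w x (Some None) @[x --> U] --> (0 : R)
  by exact: (ucvg_at (Some None) wl).
have cU : w x (Some (Some None)) @[x --> U] --> c.
  exact: (ucvg_at (Some (Some None)) wl).
(* Below the base, [s' >= a (1 - c)] eventually exceeds [a ^ 2], so that the
   height vanishes. *)
have hc : c = 1 \/ h = 0.
  have [c1|c1] := eqVneq c 1; [by left|right].
  have {c1}c1 : 0 < 1 - c by rewrite subr_gt0 lt_neqAle c1; case/andP: c01.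
  (* Half the gap serves both estimates: eventually 1 - c exceeds it at [w x] while a stays below
     it, so a^2 <= a (1 - c) there. *)
  have /cvgrPdist_lt /(_ ((1 - c) / 2)) cU' := cU.
  have /cvgrPdist_lt /(_ ((1 - c) / 2)) aU' := aU.
  have c2 : 0 < (1 - c) / 2 by rewrite divr_gt0.
  have h0 : \forall x \near U, G (F (w x)) (Some (Some None)) = 0.
    apply: filterS2 (cU' c2) (aU' c2) => x.
    rewrite sub0r normrN !ltr_norml => /andP[x1 x2] /andP[x3 x4].
    have [Fu F0] := Fi x; have [wu w0] := wi x.
    apply/eqP; apply: contraT => hn.
    have hp : 0 < hgt (F (w x)).
      by rewrite lt_neqAle eq_sym hn; have /andP[] := hgt01 (Fi x).
    have := height_gt0 F0 hp; have := Dist_ge0 Fu; rewrite /= => D0.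
    have /andP[a0 a1] := wu (Some None).
    have : w x (Some None) * (1 - w x (Some (Some None))) <=
        maxr (w x None) (w x (Some None) * (1 - w x (Some (Some None)))).
      by rewrite le_max lexx orbT.
    have : w x (Some None) * w x (Some None) <=
        w x (Some None) * (1 - w x (Some (Some None))) by rewrite ler_wpM2l//;
          lra.
    by rewrite expr2 => *; exfalso; lra.
  have h0' : G (F (w x)) (Some (Some None)) @[x --> U] --> (0 : R).
    exact: cvg_near_cst.
  exact: (cvg_unique (@Rhausdorff R) hh h0').
have /andP[h0 h1] := h01; have /andP[p0 p1] := t01; have /andP[q0 q1] := c01.
have th0 : 0 <= t0 * h by rewrite mulr_ge0.
have th1 : t0 * h <= t0 by rewrite ler_piMr.
exists ((1 - t0 + t0 * h) * c).
  by apply/andP; split; [apply: mulr_ge0|apply: mulr_ile1] => //; lra.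
have FU : Filter U by exact: ultra_proper.
have := slide_limit FU lu tt wl hh s0; rewrite /= !mulr0 addr0.
set l := ocons _ _; set l' := ocons _ _; suff -> : l = l' by [].
rewrite /l /l' /scaled_point; congr (ocons 0 (ocons 0 _));
  apply/funext => -[i|] /=.
  by rewrite mulrA.
by case: hc => ->; ring.
Qed.

Lemma slide_approaching : coord_approaching eA eA slide.
Proof.
have [eu _ _] := attach_uembedding kU kA.
split; first exact: slide_inside.
- move=> T U FU t t0 w l _ _ wi li tt wl.
  have Fi x := attach_to_collapse_inside (wi x).
  have [Fu F0] := attach_to_collapse_inside li.
  have Fl : ucvg U (F \o w) (F l) by apply: ucvg_attach_to_collapse => //;
    case: li.
  have Gl : ucvg U (G \o (F \o w)) (G (F l)).
    by apply: ucvg_collapse_to_attach => //; rewrite lt_max F0 orbT.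
  apply: slide_limit => //; first by case: li.
    exact: (ucvg_at (Some (Some None)) Gl).
  exact: (ucvg_at None Fl).
- move=> T U UU t t0 w q _ t01 wi tt wq.
  have scaled a (c : R) : A a -> 0 <= c <= 1 -> eA q = pS a c ->
      exists q', ucvg U (fun x => slide (t x) (w x)) (ocons 0 (eA q')).
    move=> Aa c01 qE; rewrite qE in wq.
    have [c' c'01 h] := slide_limit_scaled UU wi Aa c01 t01 tt wq.
    by have [q' q'E] := attach_coord_scaled kU Aa c'01; exists q'; rewrite q'E.
  have [[x qx]|[a [c [Aa c01 qE]]]] := attach_coordP (k := k) q;
    last exact: scaled qE.
  (* Over [A] the composite is not controlled by continuity, so such a point of [X] is treated as
     the point c = 1 of the cone. *)
  have [Ax|Ax] := pselect (A x).
    apply: (scaled x 1) => //; first by rewrite ler01 lexx.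
    by rewrite (scaled_point1 kU Ax).
  exists q; rewrite {}qx in wq *.
  have Fi y := attach_to_collapse_inside (wi y).
  have lu : unitf (ocons 0 (pB x)).
    by apply: unitf_ocons; [rewrite lexx ler01|exact: base_point_unit].
  have Fl : ucvg U (F \o w) (ocons 0 (pC x)).
    by rewrite -attach_to_collapse_base; exact: ucvg_attach_to_collapse.
  have Gl : ucvg U (G \o (F \o w)) (ocons 0 (pB x)).
    by apply: collapse_to_attach_limit_base => //; exact: (distA_gt0 kU).
  have hl : G (F (w y)) (Some (Some None)) @[y --> U] --> (1 : R).
    exact: (ucvg_at (Some (Some None)) Gl).
  have sl : F (w y) None @[y --> U] --> (0 : R) by exact: (ucvg_at None Fl).
  have FU : Filter U by exact: ultra_proper.
  have := slide_limit FU lu tt wq hl sl; set l := ocons _ _.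
  suff -> : l = ocons 0 (pB x) by [].
  by apply/funext => -[[[i|]|]|]; rewrite /l /=; ring.
Qed.

Lemma collapse_attach_fine_shape :
  fine_shape_equivalent R (collapse A) (attach_cone R A).
Proof.
apply: (@fine_shape_equivalent_coord R _ _ _ _ eC eA G F mix slide).
- exact: collapse_uembedding.
- exact: attach_uembedding.
- exact: collapse_to_attach_approaching.
- exact: attach_to_collapse_approaching.
- exact: mix_approaching.
- exact: slide_approaching.
- by move=> z _; rewrite mix0 mix1.
- by move=> z zi; rewrite slide0 slide1.
Qed.

End collapse_attach.

Theorem corollary1p6 (R : realType) (X : topologicalType) (A : set X)
    (metrizable_X : metrizable R X) (closed_A : closed A) :
  (compact A -> fine_shape_equivalent R (collapse A) (attach_cone R A)) /\
  (forall Q : set (X * unit_interval R)%type,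
     Q `<=` interior A `*` [set: unit_interval R] ->
     fine_shape_equivalent R
       (set_type (~` Q))
       (set_type ((([set: X] `*` [set I0 R]) `|`
                   (A `*` [set: unit_interval R])) `\` Q))).
Proof.
have [k kU] := metrizable_uembedding metrizable_X.
split=> [compact_A|Q QA]; first exact: (collapse_attach_fine_shape kU).
exact: (cylinder_fine_shape kU).
Qed.
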